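(* Assume that condition $\mathbf{(H)}$ holds. Then for every $u_0\in(\mathbb{L}^2(\Omega))^s$ the problem $$u'(t)=\mathcal{A}u(t)+F(t,u(t)),\quad t\ge 0,\qquad u(0)=u_0,$$ has a unique global (mild) solution $u:[0,+\infty)\to(\mathbb{L}^2(\Omega))^s$.
   Context: Setting. $\Omega\subset\mathbb{R}^m$ is a bounded open set, $m\in\{1,2,3\}$; $s,r\in\mathbb{N}^*$; $k_1,\dots,k_m,u_1,\dots,u_m$ are positive constants. The real Hilbert lattice $(\mathbb{L}^2(\Omega))^s$ has norm $\|z\|=\big(\sum_{j=1}^s\|z_j\|_{\mathbb{L}^2(\Omega)}^2\big)^{1/2}$ and the componentwise a.e. order. Operator. $\mathcal{A}:(H_0^1(\Omega)\cap H^2(\Omega))^s\to(\mathbb{L}^2(\Omega))^s$ is defined by $(\mathcal{A}z)(x)=\sum_{i=1}^m\big(k_i\frac{\partial^2 z(x)}{\partial x_i^2}-u_i\frac{\partial z(x)}{\partial x_i}\big)$ (acting componentwise); it generates a $C_0$-semigroup $(S(t))_{t\ge0}$ on $(\mathbb{L}^2(\Omega))^s$. Reaction term. For $\kappa=1,\dots,r$ and $j=1,\dots,s$, $l_{j\kappa},r_{j\kappa}\in\mathbb{N}$ are non-negative integers, and $h_\kappa:[0,\infty)\to\mathbb{R}$ is almost everywhere continuous with $0\le h_\kappa(t)\le d_\kappa$ for all $t\ge0$, for some constant $d_\kappa>0$. For $t\ge 0$, $F(t,z)=(F_1(t,z),\dots,F_s(t,z))$ with $$F_j(t,z)(x)=\sum_{\kappa=1}^r(r_{j\kappa}-l_{j\kappa})h_\kappa(t)\prod_{\nu=1}^s(z_\nu(x))^{l_{\nu\kappa}},\qquad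 x\in\Omega$$ (with the convention $y^0=1$). Condition $\mathbf{(H)}$: for each $\kappa\in\{1,\dots,r\}$, either $l_{j\kappa}=0$ for all $j\in\{1,\dots,s\}$, or there exists a unique $j_0\in\{1,\dots,s\}$ such that $l_{j_0\kappa}=1$ and $l_{j\kappa}=0$ for all $j\ne j_0$. Under $\mathbf{(H)}$, $F(t,z)$ is defined for all $z\in(\mathbb{L}^2(\Omega))^s$. Mild solution. For $0<a\le+\infty$, $u:[0,a)\to(\mathbb{L}^2(\Omega))^s$ is a mild solution on $[0,a)$ if $u(t)=S(t)u_0+\int_0^tS(t-\tau)F(\tau,u(\tau))\,d\tau$ for all $t\in[0,a)$. A global solution is one defined on $[0,+\infty)$. *)

(* Defs.v *)
From HB Require Import structures.
From mathcomp Require Import all_boot all_order all_algebra generic_quotient.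
From mathcomp Require Import all_classical all_reals all_analysis.
From mathcomp Require Import measurable_realfun ess_sup_inf ring lra.
Import Order.TTheory GRing.Theory Num.Theory.
Import numFieldNormedType.Exports.
Set Implicit Arguments.
Unset Strict Implicit.
Unset Printing Implicit Defensive.
Local Open Scope classical_set_scope.
Local Open Scope ring_scope.

(* The library's L^p space [LspaceType mu p1] (measurable functions modulo
   a.e. equality) carries no algebraic structure; we equip it with its
   structure of normed vector space. *)
Section Lspace_normed.
Context d (T : measurableType d) (R : realType).
Variables (mu : {measure set T -> \bar R}) (p : \bar R) (p1 : (1 <= p)%E).
Local Notation L := (LspaceType mu p1).
Local Notation AE := (@aeEqMfun _ _ R T (measurableTypeR R) mu).

HB.instance Definition _ := gen_eqMixin L.
HB.instance Definition _ := gen_choiceMixin L.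

Definition Lspace_fun (z : L) : T -> R := z.

Lemma Lspace_funP (z : L) : Lspace_fun z \in Lfun mu p.
Proof.
apply/andP; split; rewrite inE; last exact: (@Lebesgue_finite _ _ _ _ _ p1 z).
exact: (@measurable_funPT _ _ _ _ (repr (z : AE))).
Qed.

Lemma Lnorm_ae_eq (f g : T -> R) : measurable_fun setT f ->
  measurable_fun setT g -> f = g %[ae mu] ->
  ('N[mu]_p[EFin \o f] = 'N[mu]_p[EFin \o g])%E.
Proof.
move=> mf mg fg; rewrite unlock; case: p p1 => [r r1| |//] /=.
- have mN (h : T -> R) : measurable_fun setT h ->
      measurable_fun setT (fun x => (`|h x| `^ r)%:E).
    move=> mh; apply/measurable_EFinP.
    apply: (@measurableT_comp _ _ _ _ _ _ (fun x => x `^ r)) => //=.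
    exact: measurableT_comp.
  congr (_ `^ _)%E; apply: ge0_ae_eq_integral => //; [exact: mN|exact: mN|].
  by apply: filterS fg => x /(_ I) /= ->.
- move=> _; case: ifPn => // _; apply: eq_ess_sup.
  by apply: filterS fg => x /(_ I) /= ->.
Qed.

Lemma Lspace_mk_subproof (f : T -> R) (Pf : f \in Lfun mu p) :
  exists z : L, Lspace_fun z = f %[ae mu].
Proof.
have /andP[] := Pf; rewrite !inE/= => mf nf.
have mf' : @measurable_fun _ _ T (measurableTypeR R) setT f by exact: mf.
pose g : {mfun T >-> measurableTypeR R} :=
  HB.pack_for {mfun T >-> measurableTypeR R} f
    (isMeasurableFun.Build _ _ T (measurableTypeR R) f mf').
pose q : AE := \pi_(AE)%qT g.
have qg : (q : T -> R) = f %[ae mu].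
  have : (repr q == g %[mod AE])%qT by rewrite reprK.
  by rewrite eqmodE => /asboolP.
have mq : measurable_fun setT (q : T -> R) by exact: (@measurable_funPT _ _ _ _ (repr q)).
have nq : finite_norm mu p q by rewrite /finite_norm (Lnorm_ae_eq mq mf qg).
by exists (HB.pack_for L q (@isFinLebesgue.Build d T R mu p p1 q nq)).
Qed.

Lemma Lspace_eqP (y z : L) : Lspace_fun y = Lspace_fun z %[ae mu] -> y = z.
Proof.
case: y => y [[ny]]; case: z => z [[nz]] yz.
have yzE : y = z.
  rewrite -(reprK y) -(reprK z).
  by apply/eqmodP; apply/asboolP.
subst z.
have -> : ny = nz by exact: Prop_irrelevance.
by [].
Qed.


Lemma Lfun0 : (cst 0 : T -> R) \in Lfun mu p.
Proof.
by apply/andP; split; rewrite inE //=; exact: finite_norm_cst0.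
Qed.

(* the class of f if f is in L^p, and the class of 0 otherwise *)
Definition Lspace_mk (f : T -> R) : L :=
  if pselect (f \in Lfun mu p) is left Pf then sval (cid (Lspace_mk_subproof Pf))
  else sval (cid (Lspace_mk_subproof Lfun0)).

Lemma Lspace_mkE (f : T -> R) : f \in Lfun mu p ->
  Lspace_fun (Lspace_mk f) = f %[ae mu].
Proof.
by move=> Pf; rewrite /Lspace_mk; case: pselect => // ?; case: cid.
Qed.

Definition Lspace_add (y z : L) := Lspace_mk (Lspace_fun y \+ Lspace_fun z).
Definition Lspace_scale (a : R) (z : L) := Lspace_mk (a \*: Lspace_fun z).
Definition Lspace_opp (z : L) := Lspace_mk (\- Lspace_fun z).
Definition Lspace_zero := Lspace_mk (cst 0).

Lemma Lfun_scaled (a : R) (f : T -> R) : f \in Lfun mu p ->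
  (a \*: f) \in Lfun mu p.
Proof.
move=> Pf; have := (Lfun_submod_closed mu p1).2 a f (cst 0) Pf Lfun0.
suff -> : a *: f + cst 0 = a \*: f by [].
by apply/funext => x /=; rewrite addr0.
Qed.

Lemma Lspace_addE (y z : L) :
  Lspace_fun (Lspace_add y z) = Lspace_fun y \+ Lspace_fun z %[ae mu].
Proof.
by apply: Lspace_mkE; apply: (Lfun_addr_closed mu p1).2; exact: Lspace_funP.
Qed.

Lemma Lspace_scaleE (a : R) (z : L) :
  Lspace_fun (Lspace_scale a z) = a \*: Lspace_fun z %[ae mu].
Proof. by apply: Lspace_mkE; apply: Lfun_scaled; exact: Lspace_funP. Qed.

Lemma Lspace_oppE (z : L) :
  Lspace_fun (Lspace_opp z) = \- Lspace_fun z %[ae mu].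
Proof.
apply: Lspace_mkE.
suff -> : \- Lspace_fun z = - 1 \*: Lspace_fun z.
  exact/Lfun_scaled/Lspace_funP.
by apply/funext => x /=; rewrite scaleN1r.
Qed.

Lemma Lspace_zeroE : Lspace_fun Lspace_zero = cst 0 %[ae mu].
Proof. exact/Lspace_mkE/Lfun0. Qed.


Let aeS4 (P1 P2 P3 P4 Q : set T) :
  (forall x, P1 x -> P2 x -> P3 x -> P4 x -> Q x) ->
  (\forall x \ae mu, P1 x) -> (\forall x \ae mu, P2 x) ->
  (\forall x \ae mu, P3 x) -> (\forall x \ae mu, P4 x) -> \forall x \ae mu, Q x.
Proof.
by move=> PQ a b c e; apply: filterS2 (filterI a b) (filterI c e) => x [? ?] [? ?]; exact: PQ.
Qed.

Let aeS5 (P1 P2 P3 P4 P5 Q : set T) :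
  (forall x, P1 x -> P2 x -> P3 x -> P4 x -> P5 x -> Q x) ->
  (\forall x \ae mu, P1 x) -> (\forall x \ae mu, P2 x) ->
  (\forall x \ae mu, P3 x) -> (\forall x \ae mu, P4 x) ->
  (\forall x \ae mu, P5 x) -> \forall x \ae mu, Q x.
Proof.
by move=> PQ a b c e f; apply: filterS3 (filterI a b) (filterI c e) f => x [? ?] [? ?] ?; exact: PQ.
Qed.

Let addA : associative Lspace_add.
Proof.
move=> x y z; apply: Lspace_eqP.
move: (Lspace_addE x (Lspace_add y z)) (Lspace_addE y z).
move: (Lspace_addE (Lspace_add x y) z) (Lspace_addE x y).
apply: aeS4 => t /(_ I) + /(_ I) + /(_ I) + /(_ I) + _ => /= -> -> -> ->.
by rewrite addrA.
Qed.

Let addC : commutative Lspace_add.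
Proof.
move=> x y; apply: Lspace_eqP; move: (Lspace_addE x y) (Lspace_addE y x).
by apply: filterS2 => t /(_ I) + /(_ I) + _ => /= -> ->; rewrite addrC.
Qed.

Let add0 : left_id Lspace_zero Lspace_add.
Proof.
move=> x; apply: Lspace_eqP; move: (Lspace_addE Lspace_zero x) Lspace_zeroE.
by apply: filterS2 => t /(_ I) + /(_ I) + _ => /= -> ->; rewrite add0r.
Qed.

Let addN : left_inverse Lspace_zero Lspace_opp Lspace_add.
Proof.
move=> x; apply: Lspace_eqP.
move: (Lspace_addE (Lspace_opp x) x) (Lspace_oppE x) Lspace_zeroE.
by apply: filterS3 => t /(_ I) + /(_ I) + /(_ I) + _ => /= -> -> ->; rewrite addNr.
Qed.

HB.instance Definition _ := GRing.isZmodule.Build L addA addC add0 addN.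

Lemma Lspace_funD (y z : L) :
  Lspace_fun (y + z) = Lspace_fun y \+ Lspace_fun z %[ae mu].
Proof. exact: Lspace_addE. Qed.

Let scaleA a b z :
  Lspace_scale a (Lspace_scale b z) = Lspace_scale (a * b) z.
Proof.
apply: Lspace_eqP; move: (Lspace_scaleE a (Lspace_scale b z)).
move: (Lspace_scaleE b z) (Lspace_scaleE (a * b) z).
apply: filterS3 => t /(_ I) + /(_ I) + /(_ I) + _ => /= + + -> => -> ->.
by rewrite scalerA.
Qed.

Let scale1 : left_id 1 Lspace_scale.
Proof.
move=> x; apply: Lspace_eqP; move: (Lspace_scaleE 1 x).
by apply: filterS => t /(_ I) + _ => /= ->; rewrite scale1r.
Qed.

Let scaleDr : right_distributive Lspace_scale +%R.
Proof.
move=> a x y; apply: Lspace_eqP.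
move: (Lspace_scaleE a (x + y)) (Lspace_funD x y).
move: (Lspace_funD (Lspace_scale a x) (Lspace_scale a y)).
move: (Lspace_scaleE a x) (Lspace_scaleE a y).
apply: aeS5 => t /(_ I) + /(_ I) + /(_ I) + /(_ I) + /(_ I) + _ => /=.
by move=> + + + -> -> => -> -> ->; rewrite scalerDr.
Qed.

Let scaleDl x : {morph Lspace_scale^~ x : a b / a + b}.
Proof.
move=> a b; apply: Lspace_eqP.
move: (Lspace_scaleE (a + b) x) (Lspace_funD (Lspace_scale a x) (Lspace_scale b x)).
move: (Lspace_scaleE a x) (Lspace_scaleE b x).
apply: aeS4 => t /(_ I) + /(_ I) + /(_ I) + /(_ I) + _ => /=.
by move=> + + -> -> => -> ->; rewrite scalerDl.
Qed.

HB.instance Definition _ :=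
  GRing.Zmodule_isLmodule.Build R L scaleA scale1 scaleDr scaleDl.

Lemma Lspace_funZ (a : R) (z : L) :
  Lspace_fun (a *: z) = a \*: Lspace_fun z %[ae mu].
Proof. exact: Lspace_scaleE. Qed.

Definition Lspace_norm (z : L) : R := fine ('N[mu]_p[EFin \o Lspace_fun z])%E.

Let mfun_Lspace (z : L) : measurable_fun setT (Lspace_fun z).
Proof. by have /andP[] := Lspace_funP z; rewrite inE. Qed.

Let fin_Lspace (z : L) : ('N[mu]_p[EFin \o Lspace_fun z] \is a fin_num)%E.
Proof.
rewrite fin_numElt (lt_le_trans ltNy0) ?Lnorm_ge0//=.
by have /andP[_] := Lspace_funP z; rewrite inE.
Qed.

Let normD y z : Lspace_norm (y + z) <= Lspace_norm y + Lspace_norm z.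
Proof.
rewrite -lee_fin EFinD !fineK//.
rewrite (@Lnorm_ae_eq _ (Lspace_fun y \+ Lspace_fun z))//; last 2 first.
  exact: measurable_funD.
  exact: Lspace_funD.
exact: eminkowski.
Qed.

Let normZ a z : Lspace_norm (a *: z) = `|a| * Lspace_norm z.
Proof.
apply: EFin_inj; rewrite EFinM !fineK//.
rewrite (@Lnorm_ae_eq _ (a \*: Lspace_fun z))//; last 2 first.
  exact: measurable_funM.
  exact: Lspace_funZ.
exact: (LnormZ (Lfun_Sub p1 (Lspace_funP z))).
Qed.

Let norm_eq0 z : Lspace_norm z = 0 -> z = 0.
Proof.
move=> /eqP; rewrite -eqe fineK// => /eqP.
move/Lnorm_eq0_eq0; have /measurable_EFinP mz := mfun_Lspace z.
move=> /(_ mz (lt_le_trans lte01 p1)) z0.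
apply: Lspace_eqP; move: z0 Lspace_zeroE.
by apply: filterS2 => t /(_ I) [] + /(_ I) + _ => /= -> ->.
Qed.

HB.instance Definition _ := Lmodule_isNormed.Build R L normD normZ norm_eq0.

End Lspace_normed.

(* V^s with the norm (\sum_j `|z_j|^2)^(1/2); {ffun 'I_s -> V} itself is kept
   free of any norm. *)
Definition l2_product (V : Type) (s : nat) : Type := {ffun 'I_s -> V}.

Section l2_product_normed.
Context (R : realType) (V : normedModType R) (s : nat).
Local Notation X := (l2_product V s).

HB.instance Definition _ := GRing.Lmodule.copy X {ffun 'I_s -> V}.

Definition l2_norm (z : X) : R := Num.sqrt (\sum_j `|z j| ^+ 2).

Let sum_sqr_ge0 (a : 'I_s -> R) : 0 <= \sum_j a j ^+ 2.
Proof. by apply: sumr_ge0 => j _; exact: sqr_ge0. Qed.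

Let cauchy_schwarz (a b : 'I_s -> R) :
  (\sum_j a j * b j) ^+ 2 <= (\sum_j a j ^+ 2) * (\sum_j b j ^+ 2).
Proof.
set A := \sum_j a j ^+ 2; set B := \sum_j b j ^+ 2; set C := \sum_j _ * _.
have pos (x : R) : 0 <= A - 2 * x * C + x ^+ 2 * B.
  have -> : A - 2 * x * C + x ^+ 2 * B = \sum_j (a j - x * b j) ^+ 2.
    rewrite /A /B /C !mulr_sumr -sumrB -big_split/=.
    by apply: eq_bigr => j _; ring.
  exact: sum_sqr_ge0.
have B0 : 0 <= B by exact: sum_sqr_ge0.
have A0 : 0 <= A by exact: sum_sqr_ge0.
have [B_eq0|Bn0] := eqVneq B 0.
  suff -> : C = 0 by rewrite expr0n/= mulr_ge0.
  apply: big1 => j _.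
  have /eqP := B_eq0; rewrite psumr_eq0; last by move=> ? _; exact: sqr_ge0.
  by move=> /allP/(_ j (mem_index_enum j)); rewrite /= sqrf_eq0 => /eqP ->; rewrite mulr0.
have := pos (C / B); have Bp : 0 < B by rewrite lt_neqAle eq_sym Bn0.
have -> : A - 2 * (C / B) * C + (C / B) ^+ 2 * B = (A * B - C ^+ 2) / B.
  by field.
by rewrite pmulr_lge0 ?invr_gt0// subr_ge0.
Qed.

Let normD (y z : X) : l2_norm (y + z) <= l2_norm y + l2_norm z.
Proof.
rewrite /l2_norm.
set A := \sum_j `|y j| ^+ 2; set B := \sum_j `|z j| ^+ 2.
have A0 : 0 <= A by exact: sum_sqr_ge0.
have B0 : 0 <= B by exact: sum_sqr_ge0.
rewrite -(@ler_pXn2r _ 2)// ?nnegrE ?addr_ge0 ?sqrtr_ge0//.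
rewrite sqrrD !sqr_sqrtr//.
apply: (@le_trans _ _ (\sum_j (`|y j| + `|z j|) ^+ 2)).
  apply: ler_sum => j _; rewrite ffunE ler_pXn2r ?nnegrE ?addr_ge0//.
  exact: ler_normD.
have -> : \sum_j (`|y j| + `|z j|) ^+ 2 = A + (\sum_j `|y j| * `|z j|) *+ 2 + B.
  rewrite /A /B -sumrMnl -!big_split/=.
  by apply: eq_bigr => j _; rewrite sqrrD.
rewrite lerD2r lerD2l lerMn2r/= -sqrtrM//.
have C0 : 0 <= \sum_j `|y j| * `|z j| by apply: sumr_ge0 => j _; exact: mulr_ge0.
rewrite -[leLHS](ger0_norm C0).
by rewrite -sqrtr_sqr ler_wsqrtr//; exact: cauchy_schwarz.
Qed.

Let normZ (a : R) (z : X) : l2_norm (a *: z) = `|a| * l2_norm z.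
Proof.
rewrite /l2_norm -[in RHS](sqrtr_sqr a) -sqrtrM ?sqr_ge0// mulr_sumr.
congr (Num.sqrt _); apply: eq_bigr => j _; rewrite ffunE normrZ exprMn.
by rewrite real_normK ?num_real.
Qed.

Let norm_eq0 (z : X) : l2_norm z = 0 -> z = 0.
Proof.
move=> /eqP; rewrite sqrtr_eq0 => z0; apply/ffunP => j; rewrite ffunE.
have : \sum_j `|z j| ^+ 2 = 0.
  by apply/eqP; rewrite eq_le z0; exact: sum_sqr_ge0.
move/eqP; rewrite psumr_eq0 => [|? _]; last exact: sqr_ge0.
move=> /allP/(_ j (mem_index_enum j)); rewrite /= sqrf_eq0 normr_eq0.
by move=> /eqP.
Qed.

HB.instance Definition _ := Lmodule_isNormed.Build R X normD normZ norm_eq0.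

End l2_product_normed.

(* Lebesgue measure on R^m: iterated product measure on m-tuples, transported
   to the Borel sigma-algebra of 'rV[R]_m. *)
Section tuple_lebesgue_measure.
Context (R : realType).
Local Notation R_ := (measurableTypeR R).

Let cons_tuple n (x : R_ * n.-tuple R_) : n.+1.-tuple R_ :=
  [the n.+1.-tuple R_ of x.1 :: x.2].
Let uncons_tuple n (x : n.+1.-tuple R_) : R_ * n.-tuple R_ :=
  (tnth x ord0, [tuple of behead x]).

Let measurable_cons_tuple n : measurable_fun setT (@cons_tuple n).
Proof. exact: measurable_cons. Qed.

Let measurable_uncons_tuple n : measurable_fun setT (@uncons_tuple n).
Proof.
apply: measurable_fun_pair; first exact: measurable_tnth.
exact: measurable_behead.
Qed.

Let consK n : cancel (@cons_tuple n) (@uncons_tuple n).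
Proof. by move=> [a x]; congr pair; apply/val_inj. Qed.

Let leb : {sigma_finite_measure set R_ -> \bar R} := @lebesgue_measure R.

Section successor.
Variables (n : nat) (mu : {sigma_finite_measure set (n.-tuple R_) -> \bar R}).

Definition tuple_lebesgueS : set (n.+1.-tuple R_) -> \bar R :=
  pushforward (leb \x mu)%E (@cons_tuple n).

HB.instance Definition _ := Measure.copy tuple_lebesgueS
  (measure_function_pushforward__canonical__measure_function_Measure
     (leb \x mu)%E (@measurable_cons_tuple n)).

Let tuple_lebesgueS_sigma_finite : sigma_finite setT tuple_lebesgueS.
Proof.
have /sigma_finiteP[F [FT ndF Foo]] := sigma_finiteT leb.
have /sigma_finiteP[G [GT ndG Goo]] := sigma_finiteT mu.
exists (fun k => @uncons_tuple n @^-1` (F k `*` G k)).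
  apply/seteqP; split=> // x _.
  have [i _ Fi] : (\bigcup_i F i) (tnth x ord0) by rewrite -FT.
  have [j _ Gj] : (\bigcup_i G i) [tuple of behead x] by rewrite -GT.
  exists (maxn i j) => //; split => /=.
    by move: Fi; exact/subsetPset/ndF/leq_maxl.
  by move: Gj; exact/subsetPset/ndG/leq_maxr.
move=> k; have [mF Fk] := Foo k; have [mG Gk] := Goo k.
have mFG : measurable (F k `*` G k) by exact: measurableX.
split; first by rewrite -[X in measurable X]setTI; exact: measurable_uncons_tuple.
rewrite /tuple_lebesgueS /pushforward.
have -> : @cons_tuple n @^-1` (@uncons_tuple n @^-1` (F k `*` G k)) = F k `*` G k.
  rewrite -comp_preimage (_ : _ \o _ = id) ?preimage_id//.
  by apply/funext => x; exact: consK.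
by rewrite product_measure1E// lte_mul_pinfty// ge0_fin_numE.
Qed.

HB.instance Definition _ := @Measure_isSigmaFinite.Build _ _ _
  tuple_lebesgueS tuple_lebesgueS_sigma_finite.

End successor.

Fixpoint tuple_lebesgue n : {sigma_finite_measure set (n.-tuple R_) -> \bar R} :=
  if n is k.+1 then tuple_lebesgueS (tuple_lebesgue k)
  else \d_ [tuple of [::]].

End tuple_lebesgue_measure.

Section rV_lebesgue_measure.
Context (R : realType) (m : nat).
Local Notation R_ := (measurableTypeR R).

Definition rV_borel := g_sigma_algebraType (@open 'rV[R]_m).

Definition rV_of_tuple (x : m.-tuple R_) : rV_borel := \row_i tnth x i.

Lemma measurable_rV_of_tuple : measurable_fun setT rV_of_tuple.
Proof.
apply: (@measurability _ _ _ rV_borel setT rV_of_tuple (@open 'rV[R]_m) erefl).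
move=> _ [A oA <-]; rewrite setTI.
pose box (c : 'rV[rat]_m * nat) : set (m.-tuple R_) :=
  [set x | forall i, `|ratr (c.1 ord0 i) - tnth x i| < c.2.+1%:R^-1].
have mbox c : measurable (box c).
  have -> : box c = \bigcap_(i in [set: 'I_m])
      (@tnth m R_ ^~ i @^-1` ball (ratr (c.1 ord0 i) : R) c.2.+1%:R^-1).
    by apply/seteqP; split=> x /= h; [move=> i _; exact: h|move=> i; exact: h].
  apply: fin_bigcap_measurable => // i _.
  rewrite -[X in measurable X]setTI; apply: measurable_tnth => //.
  exact: measurable_ball.
pose F k : set (m.-tuple R_) :=
  if @unpickle ('rV[rat]_m * nat)%type k is Some c
  then if pselect (box c `<=` rV_of_tuple @^-1` A) then box c else set0
  else set0.
have -> : rV_of_tuple @^-1` A = \bigcup_k F k.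
  apply/seteqP; split=> x; last first.
    by move=> [k _]; rewrite /F; case: unpickle => // c; case: pselect => // h /h.
  move=> Ax; have /nbhs_ballP[e /= e0 eA] := open_nbhs_nbhs (conj oA Ax).
  have [n _ ne] : \forall n \near \oo, n.+1%:R^-1 < e / 2.
    by apply: near_infty_natSinv_lt (PosNum _); exact: divr_gt0.
  have {}ne := ne n (leqnn n).
  have n0 : 0 < n.+1%:R^-1 :> R by rewrite invr_gt0.
  have q_ i : exists q : rat, `|ratr q - tnth x i| < n.+1%:R^-1.
    have /rat_in_itvoo[q] : tnth x i - n.+1%:R^-1 < tnth x i + n.+1%:R^-1.
      by rewrite ltrBlDr -addrA ltrDl addr_gt0.
    by rewrite in_itv/= => qx; exists q; rewrite ltr_distl.
  have [q qx] := choice q_.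
  pose c : 'rV[rat]_m * nat := (\row_i q i, n).
  exists (pickle c) => //; rewrite /F pickleK.
  have bx : box c x by move=> i; rewrite mxE.
  case: pselect => // -[] y by_; apply: eA; split => // i j.
  rewrite !mxE; have := bx j; have := by_ j; rewrite !mxE /= => h1 h2.
  rewrite /ball/= (@le_lt_trans _ _ (n.+1%:R^-1 + n.+1%:R^-1))//; last by rewrite [ltRHS](splitr e) ltrD.
  rewrite -(subrKA (ratr (q j))) (le_trans (ler_normD _ _))// lerD// ltW//.
  by rewrite distrC.
apply: bigcupT_measurable => k; rewrite /F.
case: unpickle => [c|]; last exact: measurable0.
by case: pselect => ?; [exact: mbox|exact: measurable0].
Qed.

Definition rV_lebesgue : set rV_borel -> \bar R :=
  pushforward (tuple_lebesgue R m) rV_of_tuple.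

HB.instance Definition _ := Measure.copy rV_lebesgue
  (measure_function_pushforward__canonical__measure_function_Measure
     (tuple_lebesgue R m) measurable_rV_of_tuple).

Lemma open_measurable_rV (A : set 'rV[R]_m) : open A ->
  measurable (A : set rV_borel).
Proof. exact: sub_sigma_algebra. Qed.

End rV_lebesgue_measure.

Section Sobolev.
Context (R : realType) (m : nat) (Omega : set 'rV[R]_m) (oOmega : open Omega).

(* Elements of L^2(Omega) are represented by functions on the whole space,
   identified when they agree a.e. in Omega. *)
Definition domain_measure : set (rV_borel R m) -> \bar R :=
  mrestr (@rV_lebesgue R m) (open_measurable_rV oOmega).
HB.instance Definition _ := Measure.on domain_measure.

Definition L2 := LspaceType2 domain_measure.
HB.instance Definition _ := NormedModule.on L2.

Definition partial (i : 'I_m) (f : 'rV[R]_m -> R) : 'rV[R]_m -> R :=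
  fun x => 'D_(delta_mx 0 i) f x.

Definition smooth (f : 'rV[R]_m -> R) :=
  forall alpha : seq 'I_m, let g := foldr partial f alpha in
    continuous g /\ forall x i, derivable g x (delta_mx 0 i).

Definition test_function (phi : 'rV[R]_m -> R) :=
  let K := closure [set x | phi x != 0] in
  [/\ smooth phi, compact K & K `<=` Omega].

Definition weak_partial (i : 'I_m) (z g : L2) :=
  forall phi, test_function phi ->
    \int[domain_measure]_x (Lspace_fun z x * partial i phi x) =
    - \int[domain_measure]_x (Lspace_fun g x * phi x).

(* the closure of the test functions in H^1(Omega) *)
Definition H10 (z : L2) := exists2 g : 'I_m -> L2,
  (forall i, weak_partial i z (g i)) &
  (forall e : R, 0 < e -> exists2 phi, test_function phi &
    (\int[domain_measure]_x ((Lspace_fun z x - phi x) ^+ 2)%:E +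
     \sum_(i < m) \int[domain_measure]_x
       ((Lspace_fun (g i) x - partial i phi x) ^+ 2)%:E < e%:E)%E).

Definition H2 (z : L2) := exists (g : 'I_m -> L2) (h : 'I_m -> 'I_m -> L2),
  forall i, weak_partial i z (g i) /\ forall j, weak_partial j (g i) (h i j).

(* Differential operators are given by their graphs; a weak derivative, when it
   exists, is unique. *)
Definition adv_diff (k u : 'I_m -> R) (z w : L2) :=
  [/\ H10 z, H2 z & exists g h : 'I_m -> L2,
    (forall i, weak_partial i z (g i) /\ weak_partial i (g i) (h i)) /\
    w = \sum_(i < m) (k i *: h i - u i *: g i)].

Definition state (s : nat) := l2_product L2 s.
HB.instance Definition _ s := NormedModule.on (state s).

Definition adv_diff_sys (s : nat) (k u : 'I_m -> R) (z w : state s) :=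
  forall j, adv_diff k u (z j) (w j).

Section reaction.
Variables (s r : nat) (lc rc : 'I_s -> 'I_r -> nat) (h : 'I_r -> R -> R).

Definition reaction_fun (j : 'I_s) (t : R) (z : state s) : 'rV[R]_m -> R :=
  fun x => \sum_(q < r) ((rc j q)%:R - (lc j q)%:R) * h q t *
    \prod_(v < s) Lspace_fun (z v) x ^+ lc v q.

(* [Lspace_mk] returns 0 on functions that are not square integrable; by
   [reaction_fun_Lfun] below this does not happen under [conditionH] when Omega
   is bounded. *)
Definition reaction (t : R) (z : state s) : state s :=
  [ffun j => @Lspace_mk _ _ _ domain_measure _ (lee1n 2) (reaction_fun j t z)].

Definition conditionH := forall q : 'I_r,
  (forall j, lc j q = 0%N) \/
  exists! j0 : 'I_s, lc j0 q = 1%N /\ forall j, j <> j0 -> lc j q = 0%N.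
End reaction.
End Sobolev.

(* The values of S at negative times are irrelevant. *)
Section C0_semigroup.
Context (R : realType) (X : normedModType R).

Definition C0_semigroup (S : R -> {linear X -> X}) :=
  [/\ forall t, 0 <= t -> continuous (S t),
      forall z, S 0 z = z,
      forall t1 t2 z, 0 <= t1 -> 0 <= t2 -> S (t1 + t2) z = S t1 (S t2 z) &
      forall z, S t z @[t --> 0^'+] --> z].

(* A is the graph of the infinitesimal generator of S. *)
Definition generates (A : X -> X -> Prop) (S : R -> {linear X -> X}) :=
  C0_semigroup S /\
  forall z w, A z w <-> t^-1 *: (S t z - z) @[t --> 0^'+] --> w.
End C0_semigroup.

(* The completed measure is used because a.e. continuous functions need not be
   Borel measurable. *)
Section bochner.
Context (R : realType) (X : normedModType R).
Local Notation leb := (@completed_lebesgue_measure R).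
Definition lebR := caratheodory_type (R:=R) (mu_ext (@wlength R idfun)).

Definition simple_fun (f : lebR -> X) :=
  finite_set (range f) /\ forall c, measurable (f @^-1` [set c]).

Definition simple_integral (a b : R) (f : lebR -> X) : X :=
  \sum_(c \in [set: X]) fine (leb (`[a, b] `&` f @^-1` [set c])) *: c.

Definition bochner_integral (a b : R) (f : R -> X) (v : X) :=
  exists fn : nat -> lebR -> X,
  [/\ forall n, simple_fun (fn n),
      {ae leb, forall x, x \in `[a, b] -> fn n x @[n --> \oo] --> f x},
      (\int[leb]_(x in `[a, b]) `|f x - fn n x|%:E)%E @[n --> \oo] --> 0%E &
      simple_integral a b (fn n) @[n --> \oo] --> v].

(* The existence of the Bochner integral is part of the definition; no
   continuity or local boundedness of u is required. *)
Definition mild_solution (S : R -> {linear X -> X}) (F : R -> X -> X) (u0 : X)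
    (a : \bar R) (u : R -> X) :=
  forall t, 0 <= t -> (t%:E < a)%E ->
    exists2 v, bochner_integral 0 t (fun tau => S (t - tau) (F tau (u tau))) v &
      u t = S t u0 + v.

Definition global_mild_solution S F u0 u := mild_solution S F u0 +oo%E u.
End bochner.

(* h is only constrained on [0, +oo[ *)
Definition ae_continuous_ge0 (R : realType) (h : R -> R) :=
  {ae @completed_lebesgue_measure R, forall t,
    0 <= (t : R) -> h x @[x --> within [set y | 0 <= y] (nbhs (t : R))] --> h t}.

Lemma measurable_tuple_box (R : realType) n (M : R) :
  measurable [set x : n.-tuple (measurableTypeR R) | forall i, `|tnth x i| <= M].
Proof.
rewrite (_ : [set x | _] = \bigcap_(i in [set: 'I_n])
    (@tnth n (measurableTypeR R) ^~ i @^-1` `[- M, M])).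
  apply: fin_bigcap_measurable => // i _.
  by rewrite -[X in measurable X]setTI; apply: measurable_tnth.
apply/seteqP; split=> x /= h => [i _|i]; have := h i; rewrite /= in_itv/= ler_norml//.
exact.
Qed.

Lemma tuple_lebesgue_box (R : realType) n (M : R) :
  (tuple_lebesgue R n [set x | forall i, (`|tnth x i| <= M)%R] < +oo)%E.
Proof.
elim: n => [|n IHn] /=.
  rewrite /dirac/= indicE; exact: ltry.
set B := [set x | _] in IHn.
have mB : measurable B := @measurable_tuple_box R n M.
rewrite /tuple_lebesgueS /pushforward.
set C := (X in product_measure1 _ _ X).
have -> : C = `[- M, M] `*` B.
  apply/seteqP; split=> -[a x] /=.
    move=> h; split; first by have := h ord0; rewrite /= in_itv/= ler_norml.
    by move=> i; have := h (lift ord0 i); rewrite tnthS.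
  move=> [+ h] i; rewrite /= in_itv/= -ler_norml => ha.
  have [->|] := eqVneq i ord0; first exact: ha.
  by case: (unliftP ord0 i) => [j ->|-> /eqP//] _; rewrite tnthS; exact: h.
have mI : (@lebesgue_measure R `[(- M)%R, M] < +oo)%E.
  by rewrite lebesgue_measure_itv/=; case: ifPn => // _; rewrite -EFinB ltry.
rewrite product_measure1E//.
by rewrite lte_mul_pinfty// ge0_fin_numE.
Qed.

Section reaction_L2.
Context (R : realType) (m : nat) (Omega : set 'rV[R]_m) (oOmega : open Omega).
Hypothesis bOmega : bounded_set Omega.

Lemma domain_measure_fin : (domain_measure oOmega setT < +oo)%E.
Proof.
have [M [_ /(_ (M + 1) (ltr_pwDr ltr01 (lexx _))) OM]] := bOmega.
pose B := [set x : m.-tuple (measurableTypeR R) | forall i, `|tnth x i| <= M + 1].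
suff : (tuple_lebesgue R m (@rV_of_tuple R m @^-1` (setT `&` Omega)) <=
        tuple_lebesgue R m B)%E.
  by move=> /le_lt_trans; apply; exact: tuple_lebesgue_box.
apply: le_measure; rewrite ?inE.
- rewrite -[X in measurable X]setTI; apply: measurable_rV_of_tuple => //.
  by rewrite setTI; exact: open_measurable_rV.
- exact: measurable_tuple_box.
- move=> x [_ /OM/= xM] i; apply: le_trans xM.
  rewrite [leRHS]mx_normrE (le_trans _ (le_bigmax _ _ (ord0, i)))//=.
  by rewrite mxE.
Qed.

Lemma reaction_fun_Lfun (s r : nat) (lc rc : 'I_s -> 'I_r -> nat)
    (h : 'I_r -> R -> R) j t (z : state oOmega s) : conditionH lc ->
  reaction_fun lc rc h j t z \in Lfun (domain_measure oOmega) 2%:E.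
Proof.
move=> H.
have sumL (I : Type) (e : seq I) (F : I -> 'rV[R]_m -> R) :
    (forall i, F i \in Lfun (domain_measure oOmega) 2%:E) ->
    (fun x => \sum_(i <- e) F i x) \in Lfun (domain_measure oOmega) 2%:E.
  move=> FL; elim: e => [|i e IH].
    rewrite (_ : (fun _ => _) = cst 0); first exact: (Lfun0 _ (lee1n 2)).
    by apply/funext => x; rewrite big_nil.
  rewrite (_ : (fun _ => _) = F i \+ (fun x => \sum_(i <- e) F i x)).
    exact: (Lfun_addr_closed _ (lee1n 2)).2.
  by apply/funext => x; rewrite big_cons.
apply: sumL => q.
apply: (Lfun_scaled (lee1n 2)).
have [l0|[j0 [[l1 l0] _]]] := H q.
  rewrite (_ : (fun _ => _) = cst 1).
    apply/andP; split; rewrite inE //=.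
    rewrite /finite_norm Lnorm_cst1 poweR_lty//.
    exact: domain_measure_fin.
  by apply/funext => x; rewrite big1// => v _; rewrite l0 expr0.
rewrite (_ : (fun _ => _) = Lspace_fun (z j0)); first exact: Lspace_funP.
apply/funext => x; rewrite (bigD1 j0)//= l1 expr1 big1 ?mulr1// => v /eqP vj.
by rewrite l0// expr0.
Qed.

End reaction_L2.

(* Main.v *)
Require Import Defs.
From HB Require Import structures.
From mathcomp Require Import all_boot all_order all_algebra.
From mathcomp Require Import all_classical all_reals all_analysis.
From mathcomp Require Import measurable_realfun.
From mathcomp Require Import ring lra.
Import Order.TTheory GRing.Theory Num.Theory.
Import numFieldNormedType.Exports.
Set Implicit Arguments.
Unset Strict Implicit.
Unset Printing Implicit Defensive.
Local Open Scope classical_set_scope.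
Local Open Scope ring_scope.

(* Under condition (H) the reaction is affine, F(t,z) = sum_q h_q(t) (D_q z + c_q)
   with D_q acting on components only. Hence F is globally Lipschitz in z, and
   Picard iteration with weights exp(l t) gives existence; the integrands are
   bounded and right continuous a.e., so they are Bochner integrable as limits
   of step functions.

   A mild solution is not assumed locally bounded, so Gronwall cannot be applied
   to the difference w = u - v directly. But D_q preserves the generator, hence
   commutes with S, and y(t) = S(T-t) w(t) satisfies
   y(t) = int_0^t sum_q h_q(s) D_q y(s) ds with an integrand that is integrable
   on [0,T]. Gronwall applies to y, and y(T) = w(T). *)

(** * Simple functions *)

(** A mild solution provides, for each t separately, a Bochner integral of s -> S(t-s) F(s, u(s)).
    The kernel changes with t, so finiteness at one time says nothing about other times. Applying
    S(T-t) turns every kernel into S(T-s): the integrals for all t <= T then share a single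
    integrand, and the integral of its norm over [0, T] bounds y. The price is that the Lipschitz
    estimate must hold behind S(T-t). A general Lipschitz F does not satisfy this, since S(T-t) may
    shrink z - z' much more than F(t,z) - F(t,z'); this is what commutation repairs. Commutation of
    S with a bounded L preserving the graph of the generator is first proved for y in the domain,
    where s -> S(t-s) L S(s) y has right derivative 0, and then extended by density, time averages
    of orbits being in the domain. The argument needs the basic theory of C_0-semigroups, of Bochner
    integrals of right continuous functions, and completeness of the state space. *)

Section simple_maps.
Context (R : realType).
Local Notation leb := (@completed_lebesgue_measure R).
Local Notation lebR := (lebR R).

Lemma measurable_lebR (A : set R) :
  @measurable _ (measurableTypeR R) A -> @measurable _ lebR A.
Proof. exact: sub_caratheodory. Qed.

Lemma measurable_lebR_itv (a b : R) : @measurable _ lebR `[a, b].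
Proof. by apply: measurable_lebR; exact: measurable_itv. Qed.

Lemma leb_itv_cc (a b : R) : a <= b -> leb `[a, b] = (b - a)%:E.
Proof.
move=> ab; rewrite (_ : leb _ = @lebesgue_measure R `[a, b])// lebesgue_measure_itv/=.
by rewrite lte_fin; case: ltgtP ab => //= -> _; rewrite subrr.
Qed.

Lemma leb_itv_oc (a b : R) : a <= b -> leb `]a, b] = (b - a)%:E.
Proof.
move=> ab; rewrite (_ : leb _ = @lebesgue_measure R `]a, b])// lebesgue_measure_itv/=.
by rewrite lte_fin; case: ltgtP ab => //= -> _; rewrite subrr.
Qed.

Lemma leb_itv_fin (a b : R) (A : set lebR) : measurable A ->
  leb (`[a, b] `&` A) \is a fin_num.
Proof.
move=> mA; rewrite ge0_fin_numE//; apply: (@le_lt_trans _ _ (leb `[a, b])).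
  apply: le_measure; rewrite ?inE//; last exact: measurable_lebR_itv.
  by apply: measurableI => //; exact: measurable_lebR_itv.
rewrite (_ : leb _ = @lebesgue_measure R `[a, b])// lebesgue_measure_itv/=.
by case: ifP => _; rewrite ?ltry.
Qed.

Definition leb_measure : {measure set lebR -> \bar R} := leb.

#[global] Instance ae_leb_filter : Filter (almost_everywhere leb).
Proof. exact: (ae_filter_ringOfSetsType leb_measure). Qed.

(** The conditions of [simple_fun] for an arbitrary codomain, so that booleans, grid indices and
    pairs of values can serve as labels of a partition. *)
Definition simple_map (Y : Type) (p : lebR -> Y) :=
  finite_set (range p) /\ forall y, measurable (p @^-1` [set y]).

(** No structure on [A] is required, because only finitely many fibres are nonempty. *)
Lemma simple_map_preimage (Y : choiceType) (p : lebR -> Y) (A : set Y) :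
  simple_map p -> measurable (p @^-1` A).
Proof.
move=> [fp mp].
rewrite (_ : _ @^-1` _ = \bigcup_(y in range p `&` A) p @^-1` [set y]).
  by apply: fin_bigcup_measurable; [exact: finite_setIl|move=> y _; exact: mp].
apply/seteqP; split=> [x Ax|x [y [_ Ay] /= ->]//].
by exists (p x) => //; split => //; exists x.
Qed.

Lemma simple_map_comp (Y Z : choiceType) (p : lebR -> Y) (phi : Y -> Z) :
  simple_map p -> simple_map (phi \o p).
Proof.
move=> sp; split.
  by rewrite -[range _](image_comp p phi); apply: finite_image; case: sp.
by move=> z; exact: (@simple_map_preimage _ _ (phi @^-1` [set z]) sp).
Qed.

Lemma simple_map_pair (Y Z : choiceType) (p : lebR -> Y) (q : lebR -> Z) :
  simple_map p -> simple_map q -> simple_map (fun x => (p x, q x)).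
Proof.
move=> [fp mp] [fq mq]; split.
  apply: (@sub_finite_set _ _ (range p `*` range q)); last exact: finite_setX.
  by move=> _ [x _ <-]; split; exists x.
move=> [y z]; rewrite (_ : _ @^-1` _ = p @^-1` [set y] `&` q @^-1` [set z]).
  exact: measurableI.
by apply/seteqP; split=> x /= [-> ->].
Qed.

End simple_maps.

Section simple_integral.
Context (R : realType) (X : normedModType R).
Local Notation leb := (@completed_lebesgue_measure R).
Local Notation lebR := (lebR R).

(* Computing the integrals of several simple functions over a common partition
   p reduces their algebraic relations to finite sums. *)
Lemma simple_integral_comp (Y : choiceType) (p : lebR -> Y) (phi : Y -> X)
    (D : set Y) a b : simple_map p -> finite_set D -> range p `<=` D ->
  simple_integral a b (phi \o p) =
    \sum_(y \in D) fine (leb (`[a, b] `&` p @^-1` [set y])) *: phi y.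
Proof.
move=> sp fD pD; rewrite /simple_integral.
(* Values outside the image of [D] have an empty fibre and contribute 0. *)
rewrite -(fsbig_widen (phi @` D) setT)//; last first.
  move=> c /= [_ cD]; rewrite (_ : _ @^-1` _ = set0) ?setI0 ?measure0 ?scale0r//.
  by rewrite -subset0 => x /= xc; apply: cD; exists (p x) => //; apply: pD; exists x.
(* The fibre over [c] is the disjoint union of the cells of [p] whose label is sent to [c]. *)
have E c : fine (leb (`[a, b] `&` (phi \o p) @^-1` [set c])) =
    \sum_(y \in D) (phi y == c)%:R * fine (leb (`[a, b] `&` p @^-1` [set y])).
  rewrite (_ : _ `&` _ = \bigcup_(y in D)
      (`[a, b] `&` (p @^-1` [set y] `&` [set x | phi y = c]))); last first.
    apply/seteqP; split=> [x [abx /= pxc]|x [y Dy [abx /= [<-]]]]//.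
    by exists (p x) => //; apply: pD; exists x.
  have mE y : measurable (p @^-1` [set y] `&` [set _ : lebR | phi y = c]).
    apply: measurableI; first by case: sp.
    have [yc|yc] := pselect (phi y = c).
      by rewrite (_ : [set _ | _] = setT)//; apply/seteqP; split.
    by rewrite (_ : [set _ | _] = set0)//; rewrite -subset0 => x.
  rewrite measure_fin_bigcup//; last first.
  - by move=> y _; apply: measurableI => //; exact: measurable_lebR_itv.
  - by move=> i j _ _ [x [[_ [/= <- _]] [_ [/= <- _]]]].
  rewrite fsbig_finite//= -sum_fine; last by move=> y _; exact: leb_itv_fin.
  rewrite [RHS]fsbig_finite//=; apply: eq_bigr => y _.
  have [yc|yc] := eqVneq (phi y) c.
    by rewrite mul1r; congr (fine (leb _)); apply/seteqP; split=> x /= [? ?]//; split=> //; tauto.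
  rewrite mul0r (_ : _ `&` _ = set0) ?measure0// -subset0 => x /= [_ [_ /eqP]].
  by apply/negP.
under eq_fsbigr do rewrite E.
have fE : finite_set (phi @` D) by exact: finite_image.
rewrite fsbig_finite//=.
under eq_bigr do rewrite fsbig_finite//= scaler_suml.
(* After the exchange, each label [y] survives only in the term [c = phi y]. *)
rewrite exchange_big/= [RHS]fsbig_finite//=; apply: eq_big_seq => y.
rewrite in_fset_set// inE => Dy.
rewrite (bigD1_seq (phi y))/= ?finmap.fset_uniq//; last first.
  by rewrite in_fset_set// inE; exists y.
rewrite eqxx mul1r big1 ?addr0// => c cy.
by rewrite eq_sym (negbTE cy) mul0r scale0r.
Qed.

Lemma simple_integral_cst0 a b : simple_integral a b (cst 0 : lebR -> X) = 0.
Proof.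
rewrite /simple_integral fsbig1// => c _.
have [->|c0] := eqVneq c 0; first by rewrite scaler0.
rewrite (_ : _ `&` _ = set0) ?measure0 ?scale0r// -subset0 => x [_ /= /esym/eqP].
by apply/negP.
Qed.

Lemma simple_fun_map (f : lebR -> X) : simple_fun f -> simple_map f.
Proof. by []. Qed.

Lemma simple_fun_comp2 (f g : lebR -> X) (op : X -> X -> X) :
  simple_fun f -> simple_fun g -> simple_fun (fun x => op (f x) (g x)).
Proof.
move=> sf sg.
exact: (@simple_map_comp _ _ _ _ (fun y : X * X => op y.1 y.2)
  (simple_map_pair (simple_fun_map sf) (simple_fun_map sg))).
Qed.

Lemma simple_integralB a b (f g : lebR -> X) : simple_fun f -> simple_fun g ->
  simple_integral a b (f \- g) = simple_integral a b f - simple_integral a b g.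
Proof.
move=> sf sg; have sfg := simple_map_pair sf sg; have [fin _] := sfg.
rewrite -[f \- g]/((fun y => y.1 - y.2) \o (fun x => (f x, g x))).
rewrite -[in X in _ = X - _](_ : fst \o (fun x => (f x, g x)) = f)//.
rewrite -[in X in _ = _ - X](_ : snd \o (fun x => (f x, g x)) = g)//.
rewrite !(simple_integral_comp _ _ _ sfg fin)// !fsbig_finite//= -sumrB.
by apply: eq_bigr => y _; rewrite scalerBr.
Qed.

Lemma measurable_norm_simple (f : lebR -> X) D : simple_fun f ->
  measurable_fun D (fun x => `|f x|%:E).
Proof.
move=> sf mD B mB; apply: measurableI => //.
exact: (@simple_map_preimage _ _ f ((fun y => `|y|%:E) @^-1` B) (simple_fun_map sf)).
Qed.

Lemma integral_norm_simple a b (f : lebR -> X) (D : set X) : simple_fun f ->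
  finite_set D -> range f `<=` D ->
  (\int[leb]_(x in `[a, b]) `|f x|%:E =
   (\sum_(y \in D) fine (leb (`[a, b] `&` f @^-1` [set y])) * `|y|)%:E)%E.
Proof.
move=> sf fD fDr; have mab := measurable_lebR_itv a b.
(* The norm of [f] is the sum over [D] of the [|y|] times the indicator of the fibre of [y]. *)
transitivity (\int[leb]_(x in `[a, b])
    (\sum_(y \in D) (`|y|%:E * (\1_(f @^-1` [set y]) x)%:E)))%E.
  apply: eq_integral => x _.
  rewrite fsbig_finite//= (bigD1_seq (f x))/= ?finmap.fset_uniq//; last first.
    by rewrite in_fset_set// inE; apply: fDr; exists x.
  rewrite indicE mem_set// mule1 big1 ?adde0// => y yx.
  rewrite indicE memNset ?mule0// => /= fxy.
  by move/eqP: yx; rewrite fxy.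
have mi y : measurable_fun (`[a, b] : set lebR) (fun x => (\1_(f @^-1` [set y]) x : R)%:E).
  by apply/measurable_EFinP; apply: measurable_indic; exact: sf.2.
have ge0 y (x : lebR) : (0 <= `|y|%:E * (\1_(f @^-1` [set y]) x)%:E)%E.
  by rewrite mule_ge0// lee_fin.
rewrite (@ge0_integral_fsum _ _ _ leb _ mab _ (fun y x => `|y|%:E * (\1_(f @^-1` [set y]) x)%:E)%E
  (fun y => @measurable_funeM _ _ _ _ _ _ (mi y)) (fun y x _ => ge0 y x) D fD).
rewrite !fsbig_finite//= -sumEFin; apply: eq_bigr => y _.
rewrite (@ge0_integralZl_EFin _ _ _ leb _ mab _ _ _ _ (normr_ge0 y)); last 2 first.
- by move=> x _; rewrite lee_fin.
- exact: mi.
rewrite (@integral_indic _ _ _ leb _ mab _ (sf.2 y)).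
by rewrite EFinM fineK ?(leb_itv_fin a b (sf.2 y))// muleC setIC.
Qed.

Lemma le_norm_simple_integral a b (f : lebR -> X) : simple_fun f ->
  (`|simple_integral a b f|%:E <= \int[leb]_(x in `[a, b]) `|f x|%:E)%E.
Proof.
move=> sf; have [fin _] := sf.
rewrite (integral_norm_simple _ _ sf fin)// lee_fin.
rewrite -[f]/(id \o f) (simple_integral_comp _ _ _ sf fin)//.
rewrite !fsbig_finite//= (le_trans (ler_norm_sum _ _ _))//.
apply: ler_sum => y _; rewrite normrZ ger0_norm//.
by rewrite fine_ge0.
Qed.

Lemma integral_norm_simple_fin a b (f : lebR -> X) : simple_fun f ->
  (\int[leb]_(x in `[a, b]) `|f x|%:E < +oo)%E.
Proof.
by move=> sf; rewrite (@integral_norm_simple _ _ _ (range f)) ?ltry//; case: sf.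
Qed.

End simple_integral.

Section leb_integral.
Context (R : realType).
Local Notation leb := (@completed_lebesgue_measure R).
Local Notation lebR := (lebR R).

Lemma le_integral_leb (a b : R) (f g : lebR -> \bar R) :
  (forall x, 0 <= f x)%E ->
  measurable_fun (`[a, b] : set lebR) f -> measurable_fun (`[a, b] : set lebR) g ->
  (forall x, x \in `[a, b] -> f x <= g x)%E ->
  (\int[leb]_(x in `[a, b]) f x <= \int[leb]_(x in `[a, b]) g x)%E.
Proof.
move=> f0 mf mg fg.
exact: (@ge0_le_integral _ _ _ leb _ (measurable_lebR_itv a b) _ _ (fun x _ => f0 x) mf mg fg).
Qed.

Lemma le_integralD_leb (a b : R) (f g h : lebR -> \bar R) :
  (forall x, 0 <= f x)%E -> (forall x, 0 <= g x)%E -> (forall x, 0 <= h x)%E ->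
  measurable_fun (`[a, b] : set lebR) f -> measurable_fun (`[a, b] : set lebR) g ->
  measurable_fun (`[a, b] : set lebR) h ->
  (forall x, x \in `[a, b] -> f x <= g x + h x)%E ->
  (\int[leb]_(x in `[a, b]) f x <=
   \int[leb]_(x in `[a, b]) g x + \int[leb]_(x in `[a, b]) h x)%E.
Proof.
move=> f0 g0 h0 mf mg mh fgh.
rewrite -(@ge0_integralD _ _ _ leb _ (measurable_lebR_itv a b) _ _
  (fun x _ => g0 x) mg (fun x _ => h0 x) mh).
exact: (le_integral_leb f0 mf (emeasurable_funD mg mh) fgh).
Qed.

Lemma cvge0_near_lt (u : nat -> \bar R) (e : R) : u n @[n --> \oo] --> 0%E ->
  0 < e -> \forall n \near \oo, (u n < e%:E)%E.
Proof.
move=> u0 e0.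
have h : nbhs (0%E : \bar R) [set x | (x < e%:E)%E].
  by apply: (@open_ereal_lt' R 0%E e%:E); rewrite lte_fin.
exact: (u0 _ h).
Qed.

End leb_integral.

(** * The Bochner integral *)

Lemma simple_map_le (R : realType) (t : R) : simple_map (fun x : lebR R => (x : R) <= t).
Proof.
split; first exact: (@sub_finite_set _ _ setT).
move=> [].
  rewrite (_ : _ @^-1` _ = `]-oo, t]%classic).
    by apply: measurable_lebR; exact: measurable_itv.
  by apply/seteqP; split=> x; rewrite /= in_itv.
rewrite (_ : _ @^-1` _ = `]t, +oo[%classic).
  by apply: measurable_lebR; exact: measurable_itv.
apply/seteqP; split=> x; rewrite /= in_itv/= andbT ltNge.
  by move=> ->.
by move/negbTE.
Qed.

Section bochner_theory.
Context (R : realType) (X : normedModType R).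
Local Notation leb := (@completed_lebesgue_measure R).
Local Notation lebR := (lebR R).
Implicit Types (f g : R -> X) (v w : X) (a b : R).

(** [f] is only an a.e. limit: [|f - g|] agrees a.e. on the interval with a limsup of measurable
    functions, and completeness of the measure transfers measurability. *)
Lemma bochner_approx_measurable a b f (fn : nat -> lebR -> X) (g : lebR -> X) :
  (forall n, simple_fun (fn n)) -> simple_fun g ->
  {ae leb, forall x, x \in `[a, b] -> fn n x @[n --> \oo] --> f x} ->
  measurable_fun (`[a, b] : set lebR) (fun x => `|f x - g x|%:E).
Proof.
move=> sfn sg fnf.
apply: (@ae_measurable_fun _ _ _ leb completed_lebesgue_measure_is_complete _
  (fun x => limn_esup (fun n => `|fn n x - g x|%:E))); last first.
  apply: measurable_fun_limn_esup => n.
  exact/measurable_norm_simple/(simple_fun_comp2 (fun y z => y - z)).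
apply: filterS fnf => x fnx abx.
have cx : (`|fn n x - g x|%:E @[n --> \oo] --> `|f x - g x|%:E)%E.
  apply: cvg_EFin; first exact: nearW.
  by apply: cvg_norm; apply: cvgB; [exact: fnx|exact: cvg_cst].
by rewrite is_cvg_limn_esupE ?(cvg_lim _ cx)//; apply/cvg_ex; eexists; exact: cx.
Qed.

Lemma simple_fun_cst (z : X) : simple_fun (cst z : lebR -> X).
Proof.
split; first by apply: (@sub_finite_set _ _ [set z]) => // _ [x _ <-].
move=> c; have [<-|zc] := pselect (z = c).
  by rewrite (_ : _ @^-1` _ = setT)//; apply/seteqP; split.
by rewrite (_ : _ @^-1` _ = set0)// -subset0.
Qed.

Lemma bochner_measurable a b f v : bochner_integral a b f v ->
  measurable_fun (`[a, b] : set lebR) (fun x => `|f x|%:E).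
Proof.
move=> [fn [sfn fnf _ _]].
have := bochner_approx_measurable sfn (simple_fun_cst 0) fnf.
by congr (measurable_fun _ _); apply/funext => x; rewrite /= subr0.
Qed.

Lemma bochner_norm_le a b f v : bochner_integral a b f v ->
  (`|v|%:E <= \int[leb]_(x in `[a, b]) `|f x|%:E)%E.
Proof.
move=> bf; have mf := bochner_measurable bf.
have [fn [sfn fnf fn0 fnv]] := bf.
apply/lee_addgt0Pr => e e0; have e20 : 0 < e / 2 by rewrite divr_gt0.
have [n _ nP] : \forall n \near \oo,
    (\int[leb]_(x in `[a, b]) `|f x - fn n x|%:E < (e / 2)%:E)%E /\
    `|v - simple_integral a b (fn n)| < e / 2.
  apply: filterI; first exact: cvge0_near_lt.
  by move/cvgrPdist_lt : fnv; apply.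
have [{nP} fne ve] := nP n (leqnn n).
(* The inequality for simple functions costs one error [e / 2]; replacing [v] by the integral of
   [fn n] costs the other. *)
have le : (`|simple_integral a b (fn n)|%:E <=
    \int[leb]_(x in `[a, b]) `|f x|%:E +
    \int[leb]_(x in `[a, b]) `|f x - fn n x|%:E)%E.
  apply: le_trans (le_norm_simple_integral _ _ (sfn n)) _.
  apply: le_integralD_leb => [||||||x _].
  - by move=> x; rewrite lee_fin.
  - by move=> x; rewrite lee_fin.
  - by move=> x; rewrite lee_fin.
  - exact: measurable_norm_simple.
  - exact: mf.
  - exact: (bochner_approx_measurable sfn).
  - rewrite -EFinD lee_fin -[X in `|X| <= _](subKr (f x)).
    exact: ler_normB.
apply: (@le_trans _ _ (`|simple_integral a b (fn n)| + e / 2)%:E).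
  rewrite lee_fin -[X in `|X| <= _](subrK (simple_integral a b (fn n))) addrC.
  by rewrite (le_trans (ler_normD _ _))// lerD2l ltW.
rewrite EFinD (le_trans (leeD2r _ le))// [X in (_ <= _ + X%:E)%E](splitr e) EFinD addeA.
by rewrite leeD2r// leeD2l// ltW.
Qed.

Lemma bochner_fin a b f v : bochner_integral a b f v ->
  (\int[leb]_(x in `[a, b]) `|f x|%:E < +oo)%E.
Proof.
move=> bf; have mf := bochner_measurable bf.
have [fn [sfn fnf fn0 fnv]] := bf.
have [n _ /(_ n (leqnn n)) nfn] := cvge0_near_lt fn0 ltr01.
apply: (@le_lt_trans _ _ (\int[leb]_(x in `[a, b]) `|f x - fn n x|%:E +
  \int[leb]_(x in `[a, b]) `|fn n x|%:E)%E); last first.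
  rewrite lte_add_pinfty//; last exact: integral_norm_simple_fin.
  exact: lt_trans nfn (ltry _).
apply: le_integralD_leb => [||||||x _].
- by move=> x; rewrite lee_fin.
- by move=> x; rewrite lee_fin.
- by move=> x; rewrite lee_fin.
- exact: mf.
- exact: (bochner_approx_measurable sfn).
- exact: measurable_norm_simple.
- rewrite -EFinD lee_fin -[X in `|X| <= _](subrK (fn n x)).
  exact: ler_normD.
Qed.

Lemma bochnerB a b f g v w : bochner_integral a b f v ->
  bochner_integral a b g w -> bochner_integral a b (f \- g) (v - w).
Proof.
move=> [fn [sfn fnf fn0 fnv]] [gn [sgn gng gn0 gnw]].
have sd n : simple_fun (fn n \- gn n) by exact: (simple_fun_comp2 (fun y z => y - z)).
have cd : {ae leb, forall x, x \in `[a, b] ->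
    (fn n \- gn n) x @[n --> \oo] --> (f \- g) x}.
  by apply: filterS2 fnf gng => x fx gx xab; apply: cvgB; [exact: fx|exact: gx].
exists (fun n => fn n \- gn n); split => //.
- apply: (@squeeze_cvge _ _ _ _ (cst 0%E) _ (fun n =>
      \int[leb]_(x in `[a, b]) `|f x - fn n x|%:E +
      \int[leb]_(x in `[a, b]) `|g x - gn n x|%:E)%E).
  + apply: nearW => n; apply/andP; split; first exact: integral_ge0.
    apply: le_integralD_leb => [||||||x _].
    * by move=> x; rewrite lee_fin.
    * by move=> x; rewrite lee_fin.
    * by move=> x; rewrite lee_fin.
    * exact: (@bochner_approx_measurable _ _ _ _ _ sd (sd n) cd).
    * exact: (bochner_approx_measurable sfn).
    * exact: (bochner_approx_measurable sgn).
    * rewrite -EFinD lee_fin /= [X in `|X| <= _](_ : _ = (f x - fn n x) - (g x - gn n x)).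
        exact: ler_normB.
      by rewrite !opprB addrACA [RHS]addrACA [- g x + _]addrC.
  + exact: cvg_cst.
  + by rewrite -[X in _ --> X](adde0 0%E); apply: cvgeD.
- under eq_fun do rewrite simple_integralB//.
  exact: cvgB.
Qed.

Lemma bochner_simple a b (f : lebR -> X) : simple_fun f ->
  bochner_integral a b f (simple_integral a b f).
Proof.
move=> sf; exists (fun=> f); split => //; last exact: cvg_cst.
- by apply: aeW => x _; exact: cvg_cst.
- under eq_fun do under eq_integral do rewrite subrr normr0.
  by rewrite integral0; exact: cvg_cst.
Qed.

Lemma bochner_eq a b f g v : {in `[a, b], f =1 g} ->
  bochner_integral a b f v -> bochner_integral a b g v.
Proof.
move=> fg [fn [sfn fnf fn0 fnv]]; exists fn; split => //.
- by apply: filterS fnf => x fx xab; rewrite -fg//; exact: fx.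
- apply: cvg_trans fn0; apply: near_eq_cvg; apply: nearW => n.
  by apply: eq_integral => x; rewrite inE/= => xab; rewrite fg.
Qed.

(** Stands in for additivity over adjacent intervals: integrals up to different times become
    integrals over one interval and can be subtracted. *)
Lemma bochner_restrict a b t f v : a <= t -> t <= b -> bochner_integral a t f v ->
  bochner_integral a b (fun x => if x <= t then f x else 0) v.
Proof.
move=> at_ tb [fn [sfn fnf fn0 fnv]].
pose le_t (x : lebR) := (x : R) <= t.
have sle : simple_map le_t := simple_map_le t.
pose gn n (x : lebR) : X := if le_t x then fn n x else 0.
have sp n := simple_map_pair (sfn n) sle.
have gnE n : gn n = (fun y => if y.2 then y.1 else 0) \o (fun x => (fn n x, le_t x)) by [].
have sgn n : simple_fun (gn n) by rewrite gnE; exact: simple_map_comp.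
exists gn; split => //.
- apply: filterS fnf => x fx; rewrite in_itv/= => /andP[ax xb].
  rewrite /gn /le_t; case: ifPn => xt; last exact: cvg_cst.
  by apply: fx; rewrite in_itv/= ax.
- apply: cvg_trans fn0; apply: near_eq_cvg; apply: nearW => n.
  rewrite integral_mkcond [RHS]integral_mkcond; apply: eq_integral => x _.
  rewrite !patchE /gn /le_t !mem_setE/= !in_itv/=.
  case: (leP x t) => xt; rewrite ?andbT ?andbF.
    by rewrite (le_trans xt tb) andbT.
  by case: ifP => //; rewrite subrr normr0.
- apply: cvg_trans fnv; apply: near_eq_cvg; apply: nearW => n.
  have [fin _] := sp n.
  (* Both integrals are evaluated on the cells of the pair ([fn n], [le_t]). *)
  have E (phi : X * bool -> X) c : simple_integral a c (phi \o (fun x => (fn n x, le_t x))) = _ :=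
    @simple_integral_comp R X _ _ phi _ a c (sp n) fin (fun _ h => h).
  rewrite gnE E; apply: etrans (E fst t) _.
  rewrite !fsbig_finite//=; apply: eq_bigr => -[y []] _ /=.
    congr (fine (leb _) *: _); apply/seteqP; split=> x /=; rewrite !in_itv/=.
      by move=> [/andP[-> xt]] [<- _]; rewrite (le_trans xt tb) /le_t xt.
    by move=> [/andP[-> _]] []; rewrite /le_t => <- xt; rewrite xt.
  (* Cells beyond [t]: the truncated function is 0 there, and they do not meet [[a, t]]. *)
  rewrite scaler0 (_ : _ `&` _ = set0) ?measure0 ?scale0r// -subset0 => x /=.
  by rewrite in_itv/= => -[/andP[_]] xt []; rewrite /le_t xt.
Qed.

End bochner_theory.

(** * Integrals of exponential weights *)

Section integral_exp.
Context (R : realType).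
Local Notation leb := (@completed_lebesgue_measure R).
Local Notation lebR := (lebR R).

(** The identity is measurable from the completed sigma-algebra to the Borel one, and Lebesgue
    measure is the pushforward of its completion along it. *)
Lemma integral_leb_lebesgue (a b : R) (f : R -> \bar R) :
  measurable_fun `[a, b] f -> (forall x, 0 <= f x)%E ->
  (\int[leb]_(x in (`[a, b] : set lebR)) f x =
   \int[@lebesgue_measure R]_(x in `[a, b]) f x)%E.
Proof.
move=> mf f0.
have mid : measurable_fun (setT : set lebR) (fun x : lebR => x : measurableTypeR R).
  by move=> _ B mB; rewrite setTI; exact: measurable_lebR.
have := @ge0_integral_pushforward _ _ _ _ _ _ mid leb `[a, b]%classic f
  (measurable_itv _) mf (fun y _ => f0 y).
by move=> <-; apply: eq_measure_integral.
Qed.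

Lemma measurable_leb_itv (a b : R) (f : R -> \bar R) :
  measurable_fun `[a, b] f -> measurable_fun (`[a, b] : set lebR) (f : lebR -> _).
Proof.
move=> mf _ B mB; apply: measurable_lebR; exact: (mf (measurable_itv _)).
Qed.

Lemma measurable_scale_expR (C l : R) D :
  measurable_fun D (fun x : R => (C * expR (l * x))%:E).
Proof.
apply/measurable_EFinP/measurable_funM => //.
by apply: measurableT_comp => //; exact: measurable_funM.
Qed.

(** The factor [1 / l] is the gain that makes iterated integral estimates contract for large [l];
    the negative term at the lower end is dropped. *)
Lemma integral_scale_expR (C l t : R) : 0 <= C -> 0 < l -> 0 <= t ->
  (\int[leb]_(x in (`[0%R, t] : set lebR)) (C * expR (l * x))%:E <=
   (C * expR (l * t) / l)%:E)%E.
Proof.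
move=> C0 l0; rewrite le_eqVlt => /predU1P[<-|t0].
  rewrite integral_leb_lebesgue; last 2 first.
  - exact: measurable_scale_expR.
  - by move=> x; rewrite lee_fin mulr_ge0// expR_ge0.
  rewrite (@integral_Sset1 R _ _ 0) ?set_itv1// lee_fin.
  by rewrite divr_ge0 ?(ltW l0)// mulr_ge0// expR_ge0.
rewrite integral_leb_lebesgue; last 2 first.
- exact: measurable_scale_expR.
- by move=> x; rewrite lee_fin mulr_ge0// expR_ge0.
pose F (x : R) : R := C / l * expR (l * x).
have dF (x : R) : is_derive x (1 : R) F (C * expR (l * x)).
  rewrite /F; apply: is_derive_eq.
  rewrite /GRing.scale/=; field.
  by rewrite gt_eqF.
have cF (x : R) : {for x, continuous F}.
  by apply: differentiable_continuous; apply/derivable1_diffP.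
have cf (x : R) : {for x, continuous (fun x : R => C * expR (l * x))}.
  apply: continuousM; first exact: cst_continuous.
  apply: continuous_comp; last exact: continuous_expR.
  exact: mulrl_continuous.
rewrite (@continuous_FTC2 _ _ F 0 t t0).
- rewrite -EFinB lee_fin /F lerBlDr [leRHS]addrC mulrAC ler_wpDl//.
  by rewrite mulr_ge0 ?expR_ge0// divr_ge0// ltW.
- by apply: continuous_subspaceT => x; exact: cf.
- split => //.
  + by apply: cvg_at_right_filter; exact: cF.
  + by apply: cvg_at_left_filter; exact: cF.
- by move=> x _; rewrite derive1E; apply: derive_val.
Qed.

End integral_exp.

Section bochner_more.
Context (R : realType) (X : normedModType R).
Local Notation leb := (@completed_lebesgue_measure R).
Local Notation lebR := (lebR R).

Lemma bochner_linear (Y : normedModType R) (L : {linear X -> Y}) (C : R)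
    (a b : R) (f : R -> X) v : (forall z, `|L z| <= C * `|z|) ->
  bochner_integral a b f v -> bochner_integral a b (L \o f) (L v).
Proof.
move=> LC bf; have [fn [sfn fnf fn0 fnv]] := bf.
have cL : continuous L.
  apply: bounded_linear_continuous; apply/linear_boundedP.
  exists C; split; first exact: num_real.
  by move=> r Cr x; apply: le_trans (LC x) _; apply: ler_wpM2r => //; exact: ltW.
(* [C] may be negative when [X] is trivial, whereas a nonnegative factor is needed to pull it out of
   the integral. *)
have C1 : 0 <= Num.max C 0 by rewrite le_max lexx orbT.
have sg n : simple_fun (L \o fn n) by exact: (@simple_map_comp _ _ _ _ L (simple_fun_map (sfn n))).
have cg : {ae leb, forall x, x \in `[a, b] -> (L \o fn n) x @[n --> \oo] --> (L \o f) x}.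
  apply: filterS fnf => x fx xab; apply: (@cvg_comp _ _ _ _ L _ (nbhs (f x))); first exact: fx.
  exact: cL.
exists (fun n => L \o fn n); split => //.
- apply: (@squeeze_cvge _ _ _ _ (cst 0%E) _ (fun n =>
      (Num.max C 0)%:E * \int[leb]_(x in `[a, b]) `|f x - fn n x|%:E)%E).
  + apply: nearW => n; apply/andP; split; first exact: integral_ge0.
    have m1 := bochner_approx_measurable sfn (sfn n) fnf.
    rewrite -(@ge0_integralZl_EFin _ _ _ leb _ (measurable_lebR_itv a b) _ _ m1)//.
    apply: le_integral_leb => [x|||x _].
    * by rewrite lee_fin.
    * exact: (bochner_approx_measurable sg (sg n) cg).
    * exact: measurable_funeM.
    * rewrite -EFinM lee_fin /= -linearB (le_trans (LC _))// ler_wpM2r//.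
      by rewrite le_max lexx.
  + exact: cvg_cst.
  + by rewrite -[X in _ --> X](mule0 (Num.max C 0)%:E); apply: cvgeZl.
- rewrite (_ : (fun n => simple_integral a b (L \o fn n)) =
      L \o (fun n => simple_integral a b (fn n))).
    by apply: cvg_comp; [exact: fnv|exact: cL].
  apply/funext => n; have [fin _] := sfn n.
  have E (Z : normedModType R) (phi : X -> Z) : simple_integral a b (phi \o fn n) = _ :=
    @simple_integral_comp R Z _ _ phi _ a b (sfn n) fin (fun _ h => h).
  rewrite /= E (E X id : simple_integral a b (fn n) = _) !fsbig_finite//= linear_sum.
  by apply: eq_bigr => y _; rewrite linearZ.
Qed.

Lemma bochner_le_scale_expR (C l t : R) (f : R -> X) v : 0 <= C -> 0 < l -> 0 <= t ->
  bochner_integral 0 t f v -> (forall x, 0 <= x <= t -> `|f x| <= C * expR (l * x)) ->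
  `|v| <= C * expR (l * t) / l.
Proof.
move=> C0 l0 t0 bf fC; rewrite -lee_fin.
apply: le_trans (bochner_norm_le bf) _; apply: le_trans (integral_scale_expR C0 l0 t0).
apply: le_integral_leb => [x|||x xt].
- by rewrite lee_fin.
- exact: bochner_measurable bf.
- by apply: measurable_leb_itv; exact: measurable_scale_expR.
- by rewrite lee_fin fC.
Qed.

Lemma bochner_step (a t b : R) (z : X) : a <= t -> t <= b ->
  bochner_integral a b (fun x => if x <= t then 0 else z) ((b - t) *: z).
Proof.
move=> at_ tb.
have sg : simple_fun (fun x : lebR => if (x : R) <= t then 0 else z).
  exact: (@simple_map_comp _ _ _ (fun x : lebR => (x : R) <= t) (fun c : bool => if c then 0 else z)
    (simple_map_le t)).
suff <- : simple_integral a b (fun x : lebR => if (x : R) <= t then 0 else z) = (b - t) *: z.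
  exact: bochner_simple.
have [->|z0] := eqVneq z 0.
  rewrite scaler0 (_ : (fun _ => _) = cst 0) ?simple_integral_cst0//.
  by apply/funext => x; case: ifP.
rewrite /simple_integral -(fsbig_widen [set z] setT)//; last first.
  move=> c /= [_ /= cz]; have [->|c0] := eqVneq c 0; first by rewrite scaler0.
  rewrite (_ : _ `&` _ = set0) ?measure0 ?scale0r// -subset0 => x [_ /=].
  by case: ifP => _ => [/esym/eqP|/esym //]; apply/negP.
rewrite fsbig_set1; congr (_ *: _).
rewrite (_ : _ `&` _ = `]t, b]%classic); last first.
  apply/seteqP; split=> x /=; rewrite !in_itv/=.
    move=> [/andP[_ ->]]; case: (leP x t) => // _ /esym/eqP.
    by rewrite (negbTE z0).
  by move=> /andP[tx ->]; rewrite (le_trans at_ (ltW tx)) leNgt tx.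
by rewrite leb_itv_oc.
Qed.

(** The left-hand side is the norm of the integral over [[a, b]] of a function that vanishes up to
    [t] and equals [f - z] afterwards. With [z = 0] this yields Lipschitz bounds, with [z] a value
    of [f] right derivatives. *)
Lemma bochner_increment (a t b eps : R) (z : X) (f : R -> X) v w : a <= t -> t <= b ->
  0 <= eps -> bochner_integral a t f v -> bochner_integral a b f w ->
  (forall x, t < x <= b -> `|f x - z| <= eps) ->
  `|w - v - (b - t) *: z| <= eps * (b - t).
Proof.
move=> at_ tb e0 bv bw fz.
have bh := bochnerB (bochnerB bw (bochner_restrict at_ tb bv)) (bochner_step z at_ tb).
rewrite -lee_fin; apply: le_trans (bochner_norm_le bh) _.
have mtb : measurable (`]t, b] : set lebR) by apply: measurable_lebR; exact: measurable_itv.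
have mi : measurable_fun (`[a, b] : set lebR) (fun x => (\1_(`]t, b] : set lebR) x : R)%:E).
  by apply/measurable_EFinP; exact: measurable_indic.
apply: (@le_trans _ _ (\int[leb]_(x in (`[a, b] : set lebR))
    (eps%:E * (\1_(`]t, b] : set lebR) x)%:E))%E).
  apply: le_integral_leb => [x|||x].
  - by rewrite lee_fin.
  - exact: bochner_measurable bh.
  - exact: measurable_funeM.
  - rewrite in_itv/= => /andP[ax xb]; rewrite -EFinM lee_fin.
    case: (leP x t) => xt.
      by rewrite !subrr normr0 mulr_ge0.
    rewrite subr0 indicE mem_set ?mulr1; first by apply: fz; rewrite xt xb.
    by rewrite /= in_itv/= xt xb.
rewrite (@ge0_integralZl_EFin _ _ _ leb _ (measurable_lebR_itv a b) _ _ mi _ e0); last first.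
  by move=> x _; rewrite lee_fin.
rewrite (@integral_indic _ _ _ leb _ (measurable_lebR_itv a b) _ mtb).
rewrite (_ : _ `&` _ = `]t, b]%classic); last first.
  apply/seteqP; split=> x /=; rewrite !in_itv/=; first by case.
  by move=> /andP[tx ->]; rewrite tx (le_trans at_ (ltW tx)).
by rewrite [X in (_ * X)%E](_ : _ = (b - t)%:E) ?EFinM//; exact: leb_itv_oc.
Qed.

End bochner_more.

(** * Existence of the integral *)

Definition right_continuous_at (R : realType) (X : normedModType R) (f : R -> X) (x : R) :=
  forall e : R, 0 < e -> exists2 d : R, 0 < d & forall y, x < y < x + d -> `|f x - f y| < e.

Section bochner_existence.
Context (R : realType) (X : completeNormedModType R).
Local Notation leb := (@completed_lebesgue_measure R).
Local Notation lebR := (lebR R).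

(* Shifted by one: the value 0 marks the points outside [0, t]. *)
Definition grid_index (t : R) (n : nat) (x : lebR) : nat :=
  if (0 <= (x : R) <= t) then (Num.truncn ((x : R) * n.+1%:R)).+1 else 0%N.

Lemma simple_map_grid_index t n : simple_map (grid_index t n).
Proof.
split.
  apply: (@sub_finite_set _ _ `I_(Num.truncn (t * n.+1%:R)).+2); last exact: finite_II.
  move=> _ [x _ <-]; rewrite /grid_index/=; case: ifP => // /andP[x0 xt].
  by rewrite !ltnS le_truncn// ler_wpM2r.
move=> [|k].
  rewrite (_ : _ @^-1` _ = ~` (`[0, t]%classic)).
    by apply: measurableC; exact: measurable_lebR_itv.
  apply/seteqP; split=> x; rewrite /grid_index/= in_itv/=; case: ifP => //.
rewrite (_ : _ @^-1` _ = `[0, t]%classic `&` `[k%:R / n.+1%:R, k.+1%:R / n.+1%:R[%classic).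
  apply: measurableI; first exact: measurable_lebR_itv.
  by apply: measurable_lebR; exact: measurable_itv.
apply/seteqP; split=> x; rewrite /grid_index/= !in_itv/=.
  case: ifP => // /andP[x0 xt] [<-]; split => //.
  rewrite ler_pdivrMr// ltr_pdivlMr//; apply: truncn_itv.
  by rewrite mulr_ge0.
rewrite ler_pdivrMr// ltr_pdivlMr// => -[-> kx].
by congr S; exact: truncn_def.
Qed.

(** Sampling at the right end of the cell, capped at [t], approaches every [x < t] strictly from the
    right, so that right continuity suffices for convergence. *)
Definition grid_step (t : R) (f : R -> X) (n : nat) : lebR -> X :=
  (fun k => if k is k'.+1 then f (Num.min t (k'.+1%:R / n.+1%:R)) else 0) \o grid_index t n.

Lemma simple_grid_step t f n : simple_fun (grid_step t f n).
Proof.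
exact: (@simple_map_comp _ _ _ (grid_index t n) _ (simple_map_grid_index t n)).
Qed.

Lemma grid_step_bound t (f : R -> X) M n (x : R) : 0 <= t ->
  (forall s, 0 <= s <= t -> `|f s| <= M) -> `|grid_step t f n x| <= M.
Proof.
move=> t0 fM; rewrite /grid_step/=; case: grid_index => [|k].
  by rewrite normr0 (le_trans _ (fM 0 _))// lexx.
by apply: fM; rewrite ge_min lexx le_min t0 divr_ge0.
Qed.

Lemma grid_step_cvg t (f : R -> X) (x : R) : 0 <= x <= t ->
  (x < t -> right_continuous_at f x) -> grid_step t f n x @[n --> \oo] --> f x.
Proof.
move=> x0t fx; have /andP[x0 xt] := x0t.
have gE n : grid_step t f n x =
    f (Num.min t ((Num.truncn (x * n.+1%:R)).+1%:R / n.+1%:R)).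
  by rewrite /grid_step /grid_index/= x0t.
have xn n : x < (Num.truncn (x * n.+1%:R)).+1%:R / n.+1%:R <= x + n.+1%:R^-1.
  have /andP[h1 h2] := truncn_itv (mulr_ge0 x0 (ler0n R n.+1)).
  rewrite ltr_pdivlMr// h2/= ler_pdivrMr// mulrDl mulVf ?pnatr_eq0//.
  by rewrite -natr1 lerD2r.
move: xt; rewrite le_eqVlt => /predU1P[xt|xt].
  apply: (@cvg_trans _ (cst (f x) @ \oo)); last exact: cvg_cst.
  apply: near_eq_cvg; apply: nearW => n; rewrite gE; congr f.
  have /andP[/ltW h _] := xn n.
  rewrite -[X in Num.min X _]xt; apply/esym/min_idPl.
  exact: h.
apply/cvgrPdist_lt => e e0; have [d d0 fd] := fx xt e e0.
have [N _ nd] := near_infty_natSinv_lt (PosNum d0).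
exists N => // n Nn; rewrite gE; have /andP[h1 h2] := xn n.
apply: fd; rewrite lt_min xt h1/= gt_min; apply/orP; right.
by apply: (le_lt_trans h2); rewrite ltrD2l; exact: nd.
Qed.

Lemma bochner_exists (t M : R) (f : R -> X) : 0 <= t ->
  (forall s, 0 <= s <= t -> `|f s| <= M) ->
  {ae leb, forall x : lebR, 0 <= (x : R) < t -> right_continuous_at f x} ->
  exists v, bochner_integral 0 t f v.
Proof.
move=> t0 fM fc; pose fn := grid_step t f.
have sfn n : simple_fun (fn n) := simple_grid_step t f n.
have mt := measurable_lebR_itv 0 t.
have fnf : {ae leb, forall x : lebR, (x : R) \in `[0, t] -> fn n x @[n --> \oo] --> f x}.
  apply: filterS fc => x fx; rewrite in_itv/= => xt; apply: grid_step_cvg => // xt'.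
  by apply: fx; rewrite xt'; case/andP : xt => ->.
have md n := bochner_approx_measurable sfn (sfn n) fnf.
have fn0 : (\int[leb]_(x in (`[0%R, t] : set lebR)) `|f x - fn n x|%:E @[n --> \oo] --> 0)%E.
  (* Dominating function: both [f] and its samples are bounded by [M] on [[0, t]]. *)
  have ig : leb.-integrable (`[0%R, t] : set lebR) (cst (M + M)%:E).
    apply/integrableP; split; first exact: measurable_cst.
    rewrite integral_cst//= [X in (_ * X)%E](_ : _ = (t - 0)%:E) -?EFinM ?ltry//.
    exact: leb_itv_cc.
  have c0 : {ae leb, forall x : lebR, (x : R) \in `[0, t] ->
      (`|f x - fn n x|%:E @[n --> \oo] --> (cst 0 x : \bar R))%E}.
    apply: filterS fnf => x fx xt; apply: cvg_EFin; first exact: nearW.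
    apply/norm_cvg0P; rewrite -(subrr (f x)); apply: cvgB; first exact: cvg_cst.
    exact: fx.
  have dom : {ae leb, forall (x : lebR) n, (x : R) \in `[0, t] ->
      (`| `|f x - fn n x|%:E | <= cst (M + M)%:E x)%E}.
    apply: aeW => x n; rewrite /= in_itv/= => xt.
    rewrite lee_fin normr_id (le_trans (ler_normB _ _))// lerD ?fM//.
    exact: grid_step_bound.
  have [_ + _] := dominated_convergence mt md (measurable_cst _) c0 ig dom.
  apply: cvg_trans; apply: near_eq_cvg; apply: nearW => n.
  by apply: eq_integral => x _; rewrite /= subr0 normr_id.
have Cau : cauchy (simple_integral 0 t (fn n) @[n --> \oo]).
  apply/cauchy_ballP => e e0.
  have e20 : 0 < e / 2 by rewrite divr_gt0.
  have [N _ NP] := cvge0_near_lt fn0 e20.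
  exists (fun y => exists2 n, (N <= n)%N & y = simple_integral 0 t (fn n),
          fun y => exists2 n, (N <= n)%N & y = simple_integral 0 t (fn n)) => /=.
    by split; exists N => // n Nn; exists n.
  move=> [_ _] [/= [n Nn ->] [p Np ->]].
  rewrite /= -ball_normE /= -simple_integralB// -lte_fin.
  have sd : simple_fun (fn n \- fn p) by exact: (simple_fun_comp2 (fun y z => y - z)).
  apply: le_lt_trans (le_norm_simple_integral _ _ sd) _.
  apply: (@le_lt_trans _ _ (\int[leb]_(x in (`[0%R, t] : set lebR)) `|f x - fn n x|%:E +
     \int[leb]_(x in (`[0%R, t] : set lebR)) `|f x - fn p x|%:E)%E).
    apply: le_integralD_leb => [x|x|x||||x _].
    - by rewrite lee_fin.
    - by rewrite lee_fin.
    - by rewrite lee_fin.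
    - exact: measurable_norm_simple.
    - exact: md.
    - exact: md.
    - rewrite -EFinD lee_fin /= [leRHS]addrC.
      rewrite (_ : fn n x - fn p x = (f x - fn p x) - (f x - fn n x)).
        exact: ler_normB.
      by rewrite opprB [RHS]addrC addrA subrK.
  rewrite [X in (_ < X%:E)%E](splitr e) EFinD.
  by apply: lteD; exact: NP.
have /cvg_ex[v vP] : cvg (simple_integral 0 t (fn n) @[n --> \oo]).
  exact/cauchy_cvgP.
by exists v, fn.
Qed.

End bochner_existence.

(** * Semigroups *)

Lemma cvg_at_right_epsP (R : realType) (X : normedModType R) (f : R -> X) (x : R) l :
  f y @[y --> x^'+] --> l <->
  forall e : R, 0 < e -> exists2 d, 0 < d & forall y, x < y < x + d -> `|l - f y| < e.
Proof.
split => [/cvgrPdist_lt fl e /fl|fl].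
  rewrite /at_right near_withinE => /nbhs_ballP[d/= d0 dP]; exists d => // y /andP[xy yd].
  by apply: dP => //; rewrite /ball/= ltr0_norm ?subr_lt0// opprB ltrBlDl.
apply/cvgrPdist_lt => e /fl[d d0 dP].
rewrite /at_right near_withinE; apply/nbhs_ballP; exists d => //= y.
rewrite /ball/= => xyd xy; apply: dP; rewrite xy/=.
by move: xyd; rewrite ltr0_norm ?subr_lt0// opprB ltrBlDl.
Qed.

Lemma continuous_linear_bound (R : realType) (X Y : normedModType R) (L : {linear X -> Y}) :
  continuous L -> exists2 C : R, 0 <= C & forall z, `|L z| <= C * `|z|.
Proof.
move=> cL; have : bounded_near L (nbhs (0 : X)).
  exact/linear_bounded_continuous.
move=> /linear_boundedP[C [_ CP]]; exists (Num.max (C + 1) 0).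
  by rewrite le_max lexx orbT.
move=> z; apply: CP; rewrite lt_max; apply/orP; left.
by rewrite ltrDl.
Qed.

(** Semigroup identities control forward increments only. Let [c] be the supremum of the times up to
    which [|phi r - phi 0| <= e * r]: left continuity gives the bound at [c], and the right
    derivative carries it past [c] unless [c = T]. *)
Lemma constant_of_right_derivative0 (R : realType) (X : normedModType R)
    (T : R) (phi : R -> X) : 0 <= T ->
  (forall s e, 0 <= s < T -> 0 < e -> exists2 d, 0 < d &
     forall r, s < r < s + d -> r <= T -> `|phi r - phi s| <= e * (r - s)) ->
  (forall s e, 0 < s <= T -> 0 < e -> exists2 d, 0 < d &
     forall r, s - d < r < s -> 0 <= r -> `|phi s - phi r| <= e) ->
  phi T = phi 0.
Proof.
move=> T0 rd lc; apply/eqP; rewrite -subr_eq0 -normr_le0.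
apply/ler_addgt0Pr => e0 e00; rewrite add0r.
(* [T + 1] rather than [T], which may be 0. *)
pose e := e0 / (T + 1).
have e_gt0 : 0 < e by rewrite divr_gt0// ltr_wpDl.
suff : `|phi T - phi 0| <= e * T.
  move=> /le_trans; apply; rewrite /e mulrAC ler_pdivrMr ?ltr_wpDl//.
  by rewrite ler_wpM2l ?ltW//; lra.
pose E := [set s | 0 <= s <= T /\ forall r, 0 <= r <= s -> `|phi r - phi 0| <= e * r].
have E0 : E 0.
  split; first by rewrite lexx.
  move=> r; rewrite -eq_le => /eqP <-.
  by rewrite subrr normr0 mulr0.
have ubE : ubound E T by move=> s [/andP[]].
have hsE : has_sup E by split; [exists 0|exists T].
pose c := sup E.
have c0 : 0 <= c by exact: (ub_le_sup (proj2 hsE)).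
have cT : c <= T by apply: ge_sup => //; exists 0.
have belowc r : 0 <= r < c -> `|phi r - phi 0| <= e * r.
  move=> /andP[r0 rc]; have [s [_ Es] rs] := sup_gt (ex_intro _ 0 E0 : E !=set0) rc.
  by apply: Es; rewrite r0 ltW.
have atc : `|phi c - phi 0| <= e * c.
  move: c0; rewrite le_eqVlt => /predU1P[<-|c0]; first by rewrite subrr normr0 mulr0.
  apply/ler_addgt0Pr => eta eta0.
  have [|d d0 dP] := lc c eta _ eta0; first by rewrite c0.
  pose r := Num.max 0 (c - d / 2).
  have rP : c - d < r < c by rewrite lt_max gt_max; lra.
  have r0 : 0 <= r by rewrite le_max lexx.
  rewrite -(subrKA (phi r)) (le_trans (ler_normD _ _))// addrC lerD ?dP//.
  case/andP : rP => _ rc; rewrite (le_trans (belowc _ _)) ?r0//.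
  by rewrite ler_wpM2l// ltW.
move: cT; rewrite le_eqVlt => /predU1P[<-//|cT].
have [|d d0 dP] := rd c e _ e_gt0; first by rewrite c0.
pose r := Num.min T (c + d / 2).
have cr : c < r by rewrite lt_min cT /=; lra.
have rT : r <= T by rewrite ge_min lexx.
have rd' : r < c + d by rewrite gt_min; apply/orP; right; lra.
have : E r.
  split; first by rewrite rT (le_trans c0 (ltW cr)).
  move=> x /andP[x0 xr]; case: (ltgtP x c) => [xc|cx|->//].
  - by apply: belowc; rewrite x0.
  - rewrite -(subrKA (phi c)) (le_trans (ler_normD _ _))//.
    have -> : e * x = e * (x - c) + e * c by rewrite -mulrDr subrK.
    by rewrite lerD// dP ?cx/= ?(le_lt_trans xr)// (le_trans xr).
by move=> /(ub_le_sup (proj2 hsE)); rewrite leNgt cr.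
Qed.

Section semigroup.
Context (R : realType) (X : completeNormedModType R).
Variables (S : R -> {linear X -> X}) (hS : C0_semigroup S).

Let contS t : 0 <= t -> continuous (S t).
Proof. by case: hS => h _ _ _; exact: h. Qed.
Let S0 z : S 0 z = z.
Proof. by case: hS. Qed.
Let SD t1 t2 z : 0 <= t1 -> 0 <= t2 -> S (t1 + t2) z = S t1 (S t2 z).
Proof. by case: hS => _ _ h _; exact: h. Qed.

Lemma C0_semigroup_right0 z (e : R) : 0 < e ->
  exists2 d, 0 < d & forall t, 0 <= t < d -> `|S t z - z| < e.
Proof.
move=> e0; case: hS => _ _ _ /(_ z)/cvg_at_right_epsP/(_ e e0)[d d0 dP].
exists d => // t /andP[]; rewrite le_eqVlt => /predU1P[<-|t0] td.
  by rewrite S0 subrr normr0.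
by rewrite distrC; apply: dP; rewrite t0 add0r.
Qed.

(** Otherwise there are times t_n <= 1/(n+1) at which the operator norms exceed n+1; yet S(t_n) x
    tends to x for each x, so this family is pointwise bounded, against Banach-Steinhaus. *)
Lemma C0_semigroup_small_bound : exists d M : R, [/\ 0 < d, 1 <= M &
  forall t z, 0 <= t <= d -> `|S t z| <= M * `|z|].
Proof.
apply: contrapT => H.
have /choice[tz tzP] (n : nat) : exists tz : R * X,
    0 <= tz.1 <= n.+1%:R^-1 /\ n.+1%:R * `|tz.2| < `|S tz.1 tz.2|.
  apply: contrapT => Hn; apply: H; exists n.+1%:R^-1, n.+1%:R; split => //.
    by rewrite ler1n.
  move=> t z tn; rewrite leNgt; apply/negP => zt; apply: Hn.
  by exists (t, z).
pose F : set (X -> X) := range (fun n => S (tz n).1 : X -> X).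
have F1 f : F f -> bounded_fun_norm f /\ linear f.
  move=> [n _ <-]; split; last exact: linearP.
  have [C C0 CP] := continuous_linear_bound (contS (proj1 (andP (tzP n).1))).
  by move=> r; exists (C * r) => x xr; rewrite (le_trans (CP _))// ler_wpM2l.
have F2 : pointwise_bounded F.
  move=> x; have [d d0 dP] := @C0_semigroup_right0 x 1 ltr01.
  have [N _ NP] := near_infty_natSinv_lt (PosNum d0).
  (* The sum covers the finitely many times not yet known to be below [d]; later ones stay within 1
     of [x]. *)
  exists (`|x| + 1 + \sum_(i < N) `|S (tz i).1 x|) => _ [n _ <-].
  have [nN|Nn] := ltnP n N.
    rewrite (bigD1 (Ordinal nN))//= addrCA lerDl !addr_ge0//.
    by rewrite sumr_ge0.
  have /andP[t0 tn] := (tzP n).1.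
  rewrite -[leLHS]addr0 lerD ?sumr_ge0//.
  have /ltW h : `|S (tz n).1 x - x| < 1.
    by apply: dP; rewrite t0 (le_lt_trans tn)//; exact: NP.
  rewrite -[X in `|X| <= _](subrK x) (le_trans (ler_normD _ _))// addrC.
  by rewrite lerD2l.
have [M MP] := Banach_Steinhauss F1 F2 1.
pose n := Num.truncn M; have Mn : M < n.+1%:R by exact: truncnS_gt.
have [/andP[t0 _]] := tzP n; set t := (tz n).1; set z := (tz n).2 => zt.
have z0 : 0 < `|z|.
  rewrite normr_gt0; apply/eqP => z0; move: zt.
  by rewrite z0 linear0 normr0 mulr0 ltxx.
have := MP (S t) (ex_intro2 _ _ n I erefl) (`|z|^-1 *: z).
rewrite normrZ normfV normr_id mulVf ?gt_eqF// => /(_ (lexx _)).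
rewrite linearZ/= normrZ normfV normr_id mulrC ler_pdivrMr// => h.
have : n.+1%:R * `|z| < M * `|z| by exact: lt_le_trans zt h.
by rewrite ltr_pM2r// ltNge (ltW Mn).
Qed.

(** A time up to [T] splits into at most [n.+1] pieces of length at most [d], each costing one
    factor [M]. *)
Lemma C0_semigroup_bound (T : R) : exists2 M : R, 1 <= M &
  forall t z, 0 <= t <= T -> `|S t z| <= M * `|z|.
Proof.
have [d [M [d0 M1 MP]]] := C0_semigroup_small_bound.
have M0 : 0 <= M by exact: le_trans ler01 M1.
have step n t z : 0 <= t <= n.+1%:R * d -> `|S t z| <= M ^+ n.+1 * `|z|.
  elim: n t z => [|n IH] t z; first by rewrite mul1r expr1; exact: MP.
  move=> /andP[t0 tn]; have [td|dt] := leP t d.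
    rewrite (le_trans (MP _ _ _)) ?t0// ler_wpM2r//.
    by rewrite exprS ler_peMr// exprn_ege1.
  rewrite -(subrK d t) addrC SD ?(ltW d0) ?subr_ge0 ?(ltW dt)//.
  rewrite (le_trans (MP _ _ _)) ?(ltW d0) ?lexx// exprS -mulrA ler_wpM2l//.
  apply: IH; rewrite subr_ge0 (ltW dt)/= lerBlDr.
  by rewrite (le_trans tn)// -natr1 mulrDl mul1r.
pose n := Num.truncn (T / d).
exists (M ^+ n.+1); first exact: exprn_ege1.
move=> t z /andP[t0 tT]; apply: step; rewrite t0 (le_trans tT)//.
by rewrite -ler_pdivrMr// ltW// truncnS_gt.
Qed.

Lemma C0_semigroup_orbit_dist (T M : R) :
  (forall t z, 0 <= t <= T -> `|S t z| <= M * `|z|) ->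
  forall s t z, 0 <= s <= T -> 0 <= t <= T ->
  `|S s z - S t z| <= M * `|S `|s - t| z - z|.
Proof.
move=> MP s t z; wlog st : s t / s <= t => [wl sT tT|/andP[s0 sT] /andP[t0 tT]].
  case: (leP s t) => st; first exact: wl.
  by rewrite distrC (distrC s); apply: wl => //; exact: ltW.
rewrite distrC -{1}(subrK s t) [_ + s]addrC SD ?subr_ge0//.
rewrite -linearB [`|s - t|]distrC [`|t - s|]ger0_norm ?subr_ge0//.
by apply: MP; rewrite s0.
Qed.

Lemma C0_semigroup_uniformly_continuous (T : R) z (e : R) : 0 < e ->
  exists2 d, 0 < d & forall s t, 0 <= s <= T -> 0 <= t <= T -> `|s - t| < d ->
    `|S s z - S t z| < e.
Proof.
move=> e0; have [M M1 MP] := C0_semigroup_bound T.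
have M0 : 0 < M by exact: lt_le_trans ltr01 M1.
have [d d0 dP] := C0_semigroup_right0 z (divr_gt0 e0 M0).
exists d => // s t sT tT std.
apply: le_lt_trans (C0_semigroup_orbit_dist MP _ sT tT) _.
by rewrite mulrC -ltr_pdivlMr//; apply: dP; rewrite normr_ge0.
Qed.

Lemma right_continuous_orbit z (t : R) : 0 <= t -> right_continuous_at (fun s => S s z) t.
Proof.
move=> t0 e e0; have [d d0 dP] := C0_semigroup_uniformly_continuous (t + 1) z e0.
exists (Num.min d 1) => [|s /andP[ts]]; first by rewrite lt_min d0 ltr01.
rewrite -ltrBlDl lt_min => /andP[sd s1]; apply: dP.
- by rewrite t0/=; lra.
- by apply/andP; split; lra.
- by rewrite ltr0_norm ?subr_lt0// opprB.
Qed.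

End semigroup.

Lemma subrB_add2r (V : zmodType) (a b c p q : V) :
  (a - p) - (b - q) = (a - b - c) - (p - q - c).
Proof.
by rewrite [- (p - q - c)]opprB subrKA !opprB addrACA [RHS]addrACA [- p - b]addrC.
Qed.

Lemma bochner_point (R : realType) (X : normedModType R) (a : R) (f : R -> X) v :
  bochner_integral a a f v -> v = 0.
Proof.
move=> fv.
have fc : {in `[a, a], f =1 cst (f a)}.
  by move=> x; rewrite in_itv/= => /andP[ax xa]; congr f; apply: le_anti; rewrite ax xa.
have := bochner_norm_le (bochner_eq fc fv).
rewrite (@integral_cst _ _ _ _ _ (measurable_lebR_itv a a) `|f a|%:E).
rewrite [X in (_ * X)%E](_ : _ = (a - a)%:E); last exact: leb_itv_cc.
by rewrite subrr mule0 lee_fin normr_le0 => /eqP.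
Qed.

(** * Primitives of right continuous functions *)

Section primitives.
Context (R : realType) (X : completeNormedModType R) (f : R -> X).
Hypothesis fc : forall t, 0 <= t -> right_continuous_at f t.
Hypothesis fb : forall T, exists K, forall t, 0 <= t <= T -> `|f t| <= K.

Lemma primitive_exists : exists V : R -> X, forall t, 0 <= t -> bochner_integral 0 t f (V t).
Proof.
have /choice[V VP] (t : R) : exists v, 0 <= t -> bochner_integral 0 t f v.
  have [t0|t0] := leP 0 t; last by exists 0.
  have [K KP] := fb t.
  have [|v vP] := bochner_exists t0 KP; last by exists v.
  by apply: aeW => x /andP[x0 _]; exact: fc.
by exists V.
Qed.

Variable V : R -> X.
Hypothesis VP : forall t, 0 <= t -> bochner_integral 0 t f (V t).

Lemma primitive_right_derivative s (e : R) : 0 <= s -> 0 < e -> exists2 d, 0 < d &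
  forall r, s <= r < s + d -> `|V r - V s - (r - s) *: f s| <= e * (r - s).
Proof.
move=> s0 e0; have [d d0 dP] := fc s0 e0.
exists d => // r /andP[sr rd].
apply: (bochner_increment s0 sr (ltW e0) (VP s0)); first exact: VP (le_trans s0 sr).
by move=> x /andP[sx xr]; rewrite distrC ltW// dP// sx (le_lt_trans xr).
Qed.

Lemma primitive_lipschitz T K : 0 <= K -> (forall t, 0 <= t <= T -> `|f t| <= K) ->
  forall r s, 0 <= r -> r <= s -> s <= T -> `|V s - V r| <= K * (s - r).
Proof.
move=> K0 fK r s r0 rs sT.
have := @bochner_increment _ _ 0 r s K 0 _ _ _ r0 rs K0 (VP r0) (VP (le_trans r0 rs)).
rewrite scaler0 subr0; apply => x /andP[rx xs]; rewrite subr0 fK//.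
by rewrite (le_trans r0 (ltW rx)) (le_trans xs).
Qed.

End primitives.

(** * The generator: domain, density and commutation *)

Section generator.
Context (R : realType) (X : completeNormedModType R).
Variables (A : X -> X -> Prop) (S : R -> {linear X -> X}) (hA : generates A S).

Let hS : C0_semigroup S. Proof. by case: hA. Qed.
Let contS t : 0 <= t -> continuous (S t).
Proof. by case: hS => h _ _ _; exact: h. Qed.
Let S0 z : S 0 z = z.
Proof. by case: hS. Qed.
Let SD t1 t2 z : 0 <= t1 -> 0 <= t2 -> S (t1 + t2) z = S t1 (S t2 z).
Proof. by case: hS => _ _ h _; exact: h. Qed.

(** Division-free form of the difference quotient, which also allows [t = 0]. *)
Lemma generatorP z w : A z w <-> forall e : R, 0 < e -> exists2 d, 0 < d &
  forall t, 0 <= t < d -> `|S t z - z - t *: w| <= e * t.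
Proof.
case: hA => _ /(_ z w) ->; rewrite cvg_at_right_epsP; split => h e e0.
  have [d d0 dP] := h e e0; exists d => // t /andP[].
  rewrite le_eqVlt => /predU1P[<- _|t0 td].
    by rewrite S0 subrr scale0r subrr normr0 mulr0.
  have := dP t; rewrite t0 add0r => /(_ td)/ltW h1.
  have -> : S t z - z - t *: w = - (t *: (w - t^-1 *: (S t z - z))).
    by rewrite scalerBr scalerA divff ?gt_eqF// scale1r opprB.
  by rewrite normrN normrZ gtr0_norm// mulrC ler_wpM2r// ltW.
have [d d0 dP] := h (e / 2) (divr_gt0 e0 (ltr0n _ 2)); exists d => // t.
rewrite add0r => /andP[t0 td]; apply: (@le_lt_trans _ _ (e / 2)); last lra.
have -> : w - t^-1 *: (S t z - z) = - (t^-1 *: (S t z - z - t *: w)).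
  by rewrite [in RHS]scalerBr scalerA mulVf ?gt_eqF// scale1r opprB.
rewrite normrN normrZ gtr0_norm ?invr_gt0// mulrC ler_pdivrMr//.
by apply: dP; rewrite (ltW t0).
Qed.

Lemma generator_semigroup s z w : 0 <= s -> A z w -> A (S s z) (S s w).
Proof.
move=> s0 /generatorP Azw; apply/generatorP => e e0.
have [C C0 CP] := continuous_linear_bound (contS s0).
have C1 : 0 < C + 1 by rewrite ltr_wpDl.
have [d d0 dP] := Azw _ (divr_gt0 e0 C1); exists d => // t td.
have /andP[t0 _] := td.
have -> : S t (S s z) - S s z - t *: S s w = S s (S t z - z - t *: w).
  by rewrite !linearB (linearZ_LR (S s)) -!SD// (addrC t s).
rewrite (le_trans (CP _))//.
apply: (@le_trans _ _ (C * (e / (C + 1) * t))); first by rewrite ler_wpM2l// dP.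
rewrite mulrA ler_wpM2r// mulrA ler_pdivrMr// mulrC ler_wpM2l ?ltW//; lra.
Qed.

Section orbit_integral.
Variables (z : X) (V : R -> X).
Hypothesis VP : forall t, 0 <= t -> bochner_integral 0 t (fun s => S s z) (V t).

Let fc t : 0 <= t -> right_continuous_at (fun s => S s z) t.
Proof. exact: right_continuous_orbit. Qed.

(* Both sides have the same right derivative in h, which avoids a change of
   variable in the Bochner integral. *)
Lemma semigroup_orbit_integral t h : 0 <= t -> 0 <= h -> S t (V h) = V (h + t) - V t.
Proof.
move=> t0 h0; pose phi r := S t (V r) - V (r + t).
have V0 : V 0 = 0 := bochner_point (VP (lexx 0)).
suff : phi h = phi 0.
  by rewrite /phi V0 linear0 !add0r => /eqP; rewrite subr_eq [- V t + _]addrC => /eqP.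
have [C C0 CP] := continuous_linear_bound (contS t0).
apply: constant_of_right_derivative0 => // [s e /andP[s0 sh] e0|s e /andP[s0 sh] e0].
  have C1 : 0 < C + 1 by rewrite ltr_wpDl.
  have [d1 d10 d1P] := primitive_right_derivative fc VP s0 (divr_gt0 e0 C1).
  have [d2 d20 d2P] := primitive_right_derivative fc VP (addr_ge0 s0 t0) (divr_gt0 e0 C1).
  exists (Num.min d1 d2) => [|r]; first by rewrite lt_min d10.
  rewrite -ltrBlDl lt_min => /and3P[sr r1 r2] rh.
  have -> : phi r - phi s = S t (V r - V s - (r - s) *: S s z) -
      (V (r + t) - V (s + t) - (r - s) *: S (s + t) z).
    by rewrite [S t (_ - _ - _)]linearB [S t (V r - _)]linearB
      (linearZ_LR (S t)) -SD// (addrC t s) -subrB_add2r.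
  have rs0 : 0 <= r - s by rewrite subr_ge0 ltW.
  have h1 : `|V r - V s - (r - s) *: S s z| <= e / (C + 1) * (r - s).
    by apply: d1P; rewrite (ltW sr) -ltrBlDl.
  have h2 : `|V (r + t) - V (s + t) - (r - s) *: S (s + t) z| <= e / (C + 1) * (r - s).
    have := d2P (r + t); rewrite opprD addrACA subrr addr0; apply.
    by rewrite lerD2r (ltW sr)/= addrAC ltrD2r -ltrBlDl.
  rewrite (le_trans (ler_normB _ _))// (le_trans (lerD (CP _) h2))//.
  rewrite (le_trans (lerD (ler_wpM2l C0 h1) (lexx _)))//.
  rewrite -[X in _ + X]mul1r -mulrDl mulrA ler_wpM2r//.
  by rewrite mulrC divfK ?gt_eqF.
(* Left continuity of [phi]: orbits are bounded on [[0, h + t]], so [V] is Lipschitz there and [phi]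
   has Lipschitz constant [C * K + K]. *)
have [M M1 MP] := C0_semigroup_bound hS (h + t).
have M0 : 0 <= M by exact: le_trans ler01 M1.
pose K := M * `|z|; have K0 : 0 <= K by rewrite mulr_ge0.
have lip := @primitive_lipschitz _ _ _ _ VP (h + t) K K0 (fun s => MP s z).
have CK : 0 < C * K + K + 1 by rewrite ltr_wpDl// addr_ge0// mulr_ge0.
exists (e / (C * K + K + 1)); first by rewrite divr_gt0.
move=> r /andP[rs1 rs] r0.
have rs0 : 0 <= s - r by rewrite subr_ge0 ltW.
have -> : phi s - phi r = S t (V s - V r) - (V (s + t) - V (r + t)).
  by rewrite /phi [S t (_ - _)]linearB (subrB_add2r _ _ 0) !subr0.
have h1 : `|V s - V r| <= K * (s - r).
  by apply: lip => //; [exact: ltW|rewrite (le_trans sh)// lerDl].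
have h2 : `|V (s + t) - V (r + t)| <= K * (s - r).
  have := lip (r + t) (s + t); rewrite opprD addrACA subrr addr0; apply.
  - exact: addr_ge0.
  - by rewrite lerD2r ltW.
  - by rewrite lerD2r.
rewrite (le_trans (ler_normB _ _))// (le_trans (lerD (CP _) h2))//.
rewrite (le_trans (lerD (ler_wpM2l C0 h1) (lexx _)))// mulrA -mulrDl.
have : s - r <= e / (C * K + K + 1) by lra.
rewrite ler_pdivlMr// => /(le_trans _); apply.
by rewrite mulrC ler_wpM2l//; lra.
Qed.

(** S(t) V(h) - V(h) equals (V(h+t) - V(h)) - V(t); the right derivatives of [V] at h and at 0 give
    the two terms. *)
Lemma generator_orbit_integral h : 0 <= h -> A (V h) (S h z - z).
Proof.
move=> h0; have V0 : V 0 = 0 := bochner_point (VP (lexx 0)).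
apply/generatorP => e e0.
have e20 : 0 < e / 2 by rewrite divr_gt0.
have [d1 d10 d1P] := primitive_right_derivative fc VP h0 e20.
have [d2 d20 d2P] := primitive_right_derivative fc VP (lexx 0) e20.
exists (Num.min d1 d2) => [|t]; first by rewrite lt_min d10.
rewrite lt_min => /and3P[t0 t1 t2].
have h1 : `|V (h + t) - V h - t *: S h z| <= e / 2 * t.
  have := d1P (h + t); rewrite lerDl t0 ltrD2l t1 [h + t - h]addrAC subrr add0r.
  exact.
have h2 : `|V t - t *: z| <= e / 2 * t.
  have := d2P t; rewrite t0 add0r t2 !subr0 S0 V0 subr0.
  exact.
rewrite semigroup_orbit_integral// scalerBr.
have -> : V (h + t) - V t - V h - (t *: S h z - t *: z) =
    (V (h + t) - V h - t *: S h z) - (V t - t *: z).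
  rewrite [V (h + t) - V t - V h]addrAC !opprB addrACA [RHS]addrACA.
  by rewrite [- V t + _]addrC.
rewrite (le_trans (ler_normB _ _))// (le_trans (lerD h1 h2))//.
by rewrite -mulrDl -splitr.
Qed.

End orbit_integral.

(** The time averages V(h)/h of the orbit lie in the domain and tend to [z] as h tends to 0. *)
Lemma generator_dense (z : X) (e : R) : 0 < e -> exists y w, A y w /\ `|z - y| <= e.
Proof.
move=> e0.
have fc t : 0 <= t -> right_continuous_at (fun s => S s z) t.
  exact: right_continuous_orbit.
have [V VP] : exists V : R -> X, forall t, 0 <= t -> bochner_integral 0 t (fun s => S s z) (V t).
  apply: primitive_exists => // T.
  have [M M1 MP] := C0_semigroup_bound hS T.
  by exists (M * `|z|) => t; exact: MP.
have V0 : V 0 = 0 := bochner_point (VP 0 (lexx 0)).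
have [d d0 dP] := primitive_right_derivative fc VP (lexx 0) e0.
pose h := d / 2; have h0 : 0 < h by rewrite divr_gt0.
have hd : h < d by rewrite /h; lra.
exists (h^-1 *: V h), (h^-1 *: (S h z - z)); split.
  have /generatorP Ah := generator_orbit_integral VP (ltW h0).
  apply/generatorP => eta eta0; have [d' d'0 d'P] := Ah _ (mulr_gt0 eta0 h0).
  exists d' => // t td.
  rewrite linearZ/= [t *: _]scalerA [t * _]mulrC -scalerA -!scalerBr normrZ.
  rewrite gtr0_norm ?invr_gt0// mulrC ler_pdivrMr// -mulrA [t * h]mulrC mulrA.
  exact: d'P.
have := dP h; rewrite (ltW h0) add0r hd => /(_ isT).
rewrite !subr0 V0 subr0 S0 => hV.
have -> : z - h^-1 *: V h = - (h^-1 *: (V h - h *: z)).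
  by rewrite scalerBr scalerA mulVf ?gt_eqF// scale1r opprB.
by rewrite normrN normrZ gtr0_norm ?invr_gt0// mulrC ler_pdivrMr.
Qed.

Lemma semigroup_commute (L : {linear X -> X}) : continuous L ->
  (forall z w, A z w -> A (L z) (L w)) ->
  forall t z, 0 <= t -> S t (L z) = L (S t z).
Proof.
move=> cL AL t z t0.
have [K K0 KP] := continuous_linear_bound cL.
have [M M1 MP] := C0_semigroup_bound hS t.
have M0 : 0 < M by exact: lt_le_trans ltr01 M1.
(* Replacing [z] by [y] changes the two sides together by at most [2 * M * K * |z - y|]; the [+ 1]
   below avoids division by 0. *)
suff domain y w : A y w -> S t (L y) = L (S t y).
  apply/eqP; rewrite -subr_eq0 -normr_le0; apply/ler_addgt0Pr => e e0.
  have MK : 0 < 2 * M * K + 1 by rewrite ltr_wpDl// !mulr_ge0// ltW.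
  have [y [w [/domain Ayw zy]]] := generator_dense z (divr_gt0 e0 MK).
  have -> : S t (L z) - L (S t z) = S t (L (z - y)) - L (S t (z - y)).
    rewrite [L (z - y)]linearB [S t (z - y)]linearB [S t (L z - _)]linearB.
    by rewrite [L (S t z - _)]linearB Ayw opprB subrKA.
  have tt : 0 <= t <= t by rewrite t0 lexx.
  rewrite (le_trans (ler_normB _ _))//.
  have h1 : `|S t (L (z - y))| <= M * (K * `|z - y|).
    by rewrite (le_trans (MP _ _ tt))// ler_wpM2l// ltW.
  have h2 : `|L (S t (z - y))| <= K * (M * `|z - y|).
    by rewrite (le_trans (KP _))// ler_wpM2l// MP.
  rewrite add0r (le_trans (lerD h1 h2))//.
  have -> : M * (K * `|z - y|) + K * (M * `|z - y|) = (2 * M * K) * `|z - y| by ring.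
  have MK0 : 0 <= 2 * M * K by rewrite !mulr_ge0// ltW.
  rewrite (le_trans (ler_wpM2l MK0 zy))// mulrA ler_pdivrMr// mulrC.
  by rewrite ler_wpM2l ?(ltW e0)//; lra.
move=> Ayw; pose phi s := S (t - s) (L (S s y)).
suff : phi t = phi 0 by rewrite /phi subrr subr0 !S0.
apply: constant_of_right_derivative0 => // [s e /andP[s0 st] e0|s e /andP[s0 st] e0].
  have As := generator_semigroup s0 Ayw.
  have /generatorP As1 := As; have /generatorP As2 := AL _ _ As.
  have K1 : 0 < M * (K + 1) by rewrite mulr_gt0// ltr_wpDl.
  have [d1 d10 d1P] := As1 _ (divr_gt0 e0 K1).
  have [d2 d20 d2P] := As2 _ (divr_gt0 e0 K1).
  exists (Num.min d1 d2) => [|r]; first by rewrite lt_min d10.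
  rewrite -ltrBlDl lt_min => /and3P[sr r1 r2] rt.
  have rs0 : 0 <= r - s by rewrite subr_ge0 ltW.
  (* Two first-order remainders at time [s]: [L] applied to that of [S s y], and that of
     [L (S s y)]. Their linear terms agree, because [L] preserves the graph. *)
  have -> : phi r - phi s = S (t - r)
     (L (S (r - s) (S s y) - S s y - (r - s) *: S s w) -
      (S (r - s) (L (S s y)) - L (S s y) - (r - s) *: L (S s w))).
    rewrite /phi -[in RHS](linearZ_LR L) [L (_ - _ - _)]linearB [L (S (r - s) _ - _)]linearB.
    rewrite -subrB_add2r subrr subr0 linearB -!SD ?subr_ge0 ?(ltW sr)//.
    by rewrite subrK subrKA.
  have trt : 0 <= t - r <= t by rewrite subr_ge0 rt lerBlDr lerDl (le_trans s0 (ltW sr)).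
  rewrite (le_trans (MP _ _ trt))//.
  have h1 := d1P (r - s); rewrite rs0 r1 in h1; have {}h1 := h1 isT.
  have h2 := d2P (r - s); rewrite rs0 r2 in h2; have {}h2 := h2 isT.
  have h3 := le_trans (KP (S (r - s) (S s y) - S s y - (r - s) *: S s w)) (ler_wpM2l K0 h1).
  rewrite (le_trans (ler_wpM2l (ltW M0) (le_trans (ler_normB _ _) (lerD h3 h2))))//.
  rewrite -[X in _ * (_ + X)]mul1r -mulrDl !mulrA ler_wpM2r//.
  by rewrite mulrAC mulfV ?gt_eqF// mul1r.
(* Left continuity of [phi]: the outer operator is compared on the fixed vector [L (S s y)], the
   inner one on the orbit of [y]. *)
have M2 : 0 < M * K + 1 by rewrite ltr_wpDl// mulr_ge0// ltW.
have [d1 d10 d1P] := C0_semigroup_uniformly_continuous hS t y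
  (divr_gt0 e0 (mulr_gt0 (ltr0n _ 2) M2)).
have [d2 d20 d2P] := C0_semigroup_uniformly_continuous hS t (L (S s y)) (divr_gt0 e0 (ltr0n _ 2)).
exists (Num.min d1 d2) => [|r]; first by rewrite lt_min d10.
rewrite ltrBlDr -ltrBlDl lt_min => /andP[/andP[r1 r2] rs] r0.
have rst : 0 <= t - r <= t by rewrite subr_ge0 (le_trans (ltW rs) st) lerBlDr lerDl.
have -> : phi s - phi r = (S (t - s) (L (S s y)) - S (t - r) (L (S s y))) +
    S (t - r) (L (S s y - S r y)).
  by rewrite [L (_ - _)]linearB linearB subrKA.
have h2 : `|S (t - s) (L (S s y)) - S (t - r) (L (S s y))| <= e / 2.
  apply/ltW/d2P => //; first by rewrite subr_ge0 st lerBlDr lerDl ltW.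
  by rewrite opprB addrC subrKA distrC gtr0_norm ?subr_gt0.
have h1 : `|S s y - S r y| <= e / (2 * (M * K + 1)).
  apply/ltW/d1P; first by rewrite (ltW s0).
    by rewrite r0 (le_trans (ltW rs)).
  by rewrite gtr0_norm ?subr_gt0.
rewrite (le_trans (ler_normD _ _))// [leRHS]splitr lerD//.
rewrite (le_trans (MP _ _ rst))// (le_trans (ler_wpM2l (ltW M0) (KP _)))//.
rewrite mulrA (le_trans (ler_wpM2l _ h1)) ?mulr_ge0 ?(ltW M0)//.
have -> : M * K * (e / (2 * (M * K + 1))) = e / 2 * (M * K / (M * K + 1)).
  by field; rewrite gt_eqF.
rewrite -[leRHS]mulr1 ler_wpM2l ?divr_ge0 ?(ltW e0)//.
by rewrite ler_pdivrMr// mul1r lerDl.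
Qed.

End generator.

(** * Lipschitz perturbations *)

Lemma subrDB_add (V : zmodType) (a b c d : V) :
  a - (b + d) = (a - (b + c)) + (c - d).
Proof. by rewrite !opprD !addrA subrK. Qed.

Lemma le0_of_geometric (R : realType) (a b : R) :
  (forall n, a <= b * 2^-1 ^+ n) -> a <= 0.
Proof.
move=> ab; have c0 : (b * 2^-1 ^+ n) @[n --> \oo] --> (b * 0).
  apply: cvgMr; apply: cvg_expr; rewrite ger0_norm ?invr_ge0//.
  by rewrite invf_lt1 ?ltr1n.
rewrite -(mulr0 b) -(cvg_lim _ c0)//; apply: limr_ge; first by apply/cvg_ex; eexists; exact: c0.
exact: nearW.
Qed.

Lemma fast_cauchy_dist (R : realType) (X : normedModType R) (x : nat -> X) (C : R) :
  (forall n, `|x n.+1 - x n| <= C * 2^-1 ^+ n) ->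
  forall k n, `|x (n + k)%N - x n| <= 2 * C * 2^-1 ^+ n.
Proof.
move=> xC k n.
have C0 : 0 <= C by have := le_trans (normr_ge0 _) (xC 0%N); rewrite expr0 mulr1.
have h0 i : 0 <= 2^-1 ^+ i :> R by rewrite exprn_ge0// invr_ge0.
(* The exact geometric sum, which is what the induction on [k] preserves. *)
suff : `|x (n + k)%N - x n| <= 2 * C * (2^-1 ^+ n - 2^-1 ^+ (n + k)).
  move=> /le_trans; apply; rewrite ler_wpM2l ?mulr_ge0// lerBlDr lerDl.
  exact: h0.
elim: k => [|k IH]; first by rewrite addn0 !subrr normr0 mulr0.
rewrite addnS -(subrKA (x (n + k)%N)) (le_trans (ler_normD _ _))//.
rewrite (le_trans (lerD (xC _) IH))// exprS.
by have := h0 (n + k)%N; lra.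
Qed.

Lemma fast_cauchy_cvg (R : realType) (X : completeNormedModType R) (x : nat -> X) (C : R) :
  (forall n, `|x n.+1 - x n| <= C * 2^-1 ^+ n) ->
  exists l, forall n, `|l - x n| <= 2 * C * 2^-1 ^+ n.
Proof.
move=> xC.
have far := fast_cauchy_dist xC.
have Cau : cauchy (x n @[n --> \oo]).
  apply/cauchy_ballP => e e0.
  have [N NP] : exists N, 2 * (2 * C) * 2^-1 ^+ N < e.
    apply: contrapT => /forallNP H.
    have : e <= 0 by apply: (@le0_of_geometric _ _ (2 * (2 * C))) => n; rewrite leNgt; apply/negP/H.
    by rewrite leNgt e0.
  exists (fun y => exists2 n, (N <= n)%N & y = x n,
          fun y => exists2 n, (N <= n)%N & y = x n) => /=.
    by split; exists N => // n Nn; exists n.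
  move=> [_ _] [/= [n Nn ->] [p Np ->]]; rewrite -ball_normE /=.
  rewrite -(subrKA (x N)) (le_lt_trans (ler_normD _ _))//.
  apply: le_lt_trans NP; rewrite [X in _ + X]distrC.
  have := far (n - N)%N N; have := far (p - N)%N N; rewrite !subnKC//; lra.
have /cvg_ex[l xl] : cvg (x n @[n --> \oo]) by exact/cauchy_cvgP.
exists l => n; apply/ler_addgt0Pr => e e0.
move/cvgrPdist_lt : xl => /(_ e e0) [N _ NP].
rewrite -(subrKA (x (n + N)%N)) (le_trans (ler_normD _ _))// addrC lerD//.
by apply/ltW/NP => /=; rewrite leq_addl.
Qed.

Section mild_solutions.
Context (R : realType) (X : completeNormedModType R).
Local Notation leb := (@completed_lebesgue_measure R).
Local Notation lebR := (lebR R).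
Variables (S : R -> {linear X -> X}) (hS : C0_semigroup S).
Variables (F : R -> X -> X) (K K' : R).
Hypothesis K0 : 0 <= K.
Hypothesis F_lipschitz : forall t z z', 0 <= t -> `|F t z - F t z'| <= K * `|z - z'|.

Let contS t : 0 <= t -> continuous (S t).
Proof. by case: hS => h _ _ _; exact: h. Qed.
Let S0 z : S 0 z = z.
Proof. by case: hS. Qed.
Let SD t1 t2 z : 0 <= t1 -> 0 <= t2 -> S (t1 + t2) z = S t1 (S t2 z).
Proof. by case: hS => _ _ h _; exact: h. Qed.

Lemma right_continuous_convolution (g : R -> X) (t x : R) : 0 <= x < t ->
  right_continuous_at g x -> right_continuous_at (fun s => S (t - s) (g s)) x.
Proof.
move=> /andP[x0 xt] gx e e0.
have [M M1 MP] := C0_semigroup_bound hS t.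
have M0 : 0 < M by exact: lt_le_trans ltr01 M1.
have e2 : 0 < e / 2 by rewrite divr_gt0.
have [d1 d10 d1P] := gx _ (divr_gt0 e2 M0).
have [d2 d20 d2P] := C0_semigroup_uniformly_continuous hS t (g x) e2.
exists (Num.min (Num.min d1 d2) (t - x)) => [|y].
  by rewrite !lt_min d10 d20 subr_gt0.
rewrite -ltrBlDl !lt_min => /andP[xy /andP[/andP[y1 y2] y3]].
have yt : y <= t by rewrite -(lerD2r (- x)) ltW.
have ty : 0 <= t - y <= t by rewrite subr_ge0 yt lerBlDr lerDl (le_trans x0 (ltW xy)).
rewrite -(subrKA (S (t - y) (g x))) (le_lt_trans (ler_normD _ _))// [ltRHS]splitr ltrD//.
  apply: d2P => //; first by rewrite subr_ge0 (ltW xt) lerBlDr lerDl.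
  by rewrite opprB addrC subrKA gtr0_norm ?subr_gt0.
rewrite -linearB (le_lt_trans (MP _ _ ty))// mulrC -ltr_pdivlMr//.
by apply: d1P; rewrite xy -ltrBlDl.
Qed.

Section existence.
Hypothesis F_bounded0 : forall t, 0 <= t -> `|F t 0| <= K'.
Hypothesis F_right_continuous : {ae leb, forall t : lebR, 0 <= (t : R) ->
  forall z, right_continuous_at (F ^~ z) t}.
Variable u0 : X.

(** The class in which the iteration runs: it makes the convolution integrand integrable, it is
    preserved by [convolution], and it passes to locally uniform limits. *)
Definition admissible (u : R -> X) :=
  (forall t, 0 <= t -> right_continuous_at u t) /\
  (forall T, exists C, forall t, 0 <= t <= T -> `|u t| <= C).

Lemma reaction_norm_le t z : 0 <= t -> `|F t z| <= K * `|z| + K'.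
Proof.
move=> t0; rewrite -[X in `|X|](subrK (F t 0)) (le_trans (ler_normD _ _))//.
by rewrite lerD ?F_bounded0// (le_trans (F_lipschitz _ _ t0))// subr0.
Qed.

Lemma right_continuous_reaction (u : R -> X) (t : R) : 0 <= t ->
  (forall z, right_continuous_at (F ^~ z) t) -> right_continuous_at u t ->
  right_continuous_at (fun s => F s (u s)) t.
Proof.
move=> t0 Fc uc e e0.
have e2 : 0 < e / 2 by rewrite divr_gt0.
have K1 : 0 < K + 1 by rewrite ltr_wpDl.
have [d1 d10 d1P] := Fc (u t) _ e2.
have [d2 d20 d2P] := uc _ (divr_gt0 e2 K1).
exists (Num.min d1 d2) => [|y]; first by rewrite lt_min d10.
rewrite -ltrBlDl lt_min => /and3P[ty y1 y2].
rewrite -(subrKA (F y (u t))) (le_lt_trans (ler_normD _ _))// [ltRHS]splitr ltr_leD//.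
  by apply: d1P; rewrite ty -ltrBlDl.
rewrite (le_trans (F_lipschitz _ _ (le_trans t0 (ltW ty))))//.
have := d2P y; rewrite ty -ltrBlDl y2 => /(_ isT)/ltW.
rewrite ler_pdivlMr// => h; apply: le_trans h.
by rewrite mulrC ler_wpM2l//; lra.
Qed.

Lemma convolution_bound (u : R -> X) T : admissible u -> exists2 B, 0 <= B &
  forall t s, 0 <= s <= t -> t <= T -> `|S (t - s) (F s (u s))| <= B.
Proof.
move=> [_ /(_ T)[C CP]]; have [M M1 MP] := C0_semigroup_bound hS T.
have M0 : 0 <= M by exact: le_trans ler01 M1.
(* The absolute value settles the sign, which is not known for [C] and [K']. *)
exists `|M * (K * C + K')| => // t s /andP[s0 st] tT.
have ts : 0 <= t - s <= T by rewrite subr_ge0 st lerBlDr (le_trans tT)// lerDl.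
rewrite (le_trans (MP _ _ ts))//; apply: le_trans (ler_norm _).
rewrite ler_wpM2l// (le_trans (reaction_norm_le _ s0))// lerD2r ler_wpM2l//.
by apply: CP; rewrite s0 (le_trans st).
Qed.

(** The default 0 is never taken for admissible [u] and [t >= 0], by [convolutionP]. *)
Definition convolution (u : R -> X) (t : R) : X :=
  xget 0 [set v | bochner_integral 0 t (fun s => S (t - s) (F s (u s))) v].

Lemma convolutionP u t : admissible u -> 0 <= t ->
  bochner_integral 0 t (fun s => S (t - s) (F s (u s))) (convolution u t).
Proof.
move=> au t0; rewrite /convolution; case: xgetP => [v _ //|no].
have [B B0 BP] := convolution_bound t au.
have [|v /no//] := @bochner_exists R X t B _ t0 (fun s st => BP t s st (lexx _)).
apply: filterS F_right_continuous => x xc /andP[x0 xt].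
apply: (@right_continuous_convolution (fun s => F s (u s))); first by rewrite x0.
apply: right_continuous_reaction => //; first exact: xc.
by case: au => h _; exact: h.
Qed.

Lemma admissible_convolution u : admissible u -> admissible (convolution u).
Proof.
move=> au; split=> [t t0 e e0|T].
  have [B B0 BP] := convolution_bound (t + 1) au.
  have e2 : 0 < e / 2 by rewrite divr_gt0.
  have [d d0 dP] := C0_semigroup_right0 hS (convolution u t) e2.
  have B1 : 0 < B + 1 by rewrite ltr_wpDl.
  exists (Num.min (Num.min d 1) (e / 2 / (B + 1))) => [|r].
    by rewrite !lt_min d0 ltr01 divr_gt0.
  rewrite -ltrBlDl !lt_min => /andP[tr /andP[/andP[r1 r2] r3]].
  have rt : 0 <= r - t by rewrite subr_ge0 ltW.
  have r0 : 0 <= r by rewrite (le_trans t0)// ltW.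
  have [C C0 CP] := continuous_linear_bound (contS rt).
  (* [S (r - t)] turns the kernel at time [t] into the kernel at time [r]; the difference of the two
     integrals then comes from []t, r]] only. *)
  have conv_t : bochner_integral 0 t (fun s => S (r - s) (F s (u s))) (S (r - t) (convolution u t)).
    apply: bochner_eq (bochner_linear CP (convolutionP au t0)) => s.
    rewrite in_itv/= => /andP[s0 st]; rewrite -SD ?subr_ge0 ?(ltW tr)//.
    by rewrite subrKA.
  have h : `|convolution u r - S (r - t) (convolution u t)| <= B * (r - t).
    have := @bochner_increment _ _ 0 t r B 0 _ _ _ t0 (ltW tr) B0 conv_t (convolutionP au r0).
    rewrite scaler0 subr0; apply => x /andP[tx xr]; rewrite subr0.
    by apply: BP; [rewrite xr (le_trans t0 (ltW tx))|lra].
  rewrite distrC -(subrKA (S (r - t) (convolution u t))) (le_lt_trans (ler_normD _ _))//.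
  rewrite [ltRHS]splitr ler_ltD//; last by apply: dP; rewrite rt.
  apply: le_trans h _; move: r3; rewrite ltr_pdivlMr// => /ltW; apply: le_trans.
  by rewrite mulrC ler_wpM2l//; lra.
have [B B0 BP] := convolution_bound T au.
exists (B * expR T) => t /andP[t0 tT].
have := bochner_le_scale_expR B0 ltr01 t0 (convolutionP au t0).
rewrite divr1 mul1r => h; apply: le_trans (h _) _.
  move=> x xt; rewrite mul1r (le_trans (BP _ _ xt tT))// ler_peMr//.
  by rewrite -expR0 ler_expR; case/andP : xt.
by rewrite ler_wpM2l// ler_expR.
Qed.

Lemma convolution_lipschitz (u v : R -> X) (T M C l t : R) : admissible u -> admissible v ->
  0 <= M -> (forall t z, 0 <= t <= T -> `|S t z| <= M * `|z|) -> 0 <= C -> 0 < l ->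
  (forall s, 0 <= s <= T -> `|u s - v s| <= C * expR (l * s)) -> 0 <= t <= T ->
  `|convolution u t - convolution v t| <= M * K * C * expR (l * t) / l.
Proof.
move=> au av M0 MP C0 l0 uv /andP[t0 tT].
apply: (bochner_le_scale_expR _ l0 t0 (bochnerB (convolutionP au t0) (convolutionP av t0))).
  by rewrite !mulr_ge0.
move=> x /andP[x0 xt]; rewrite /= -linearB.
have tx : 0 <= t - x <= T by rewrite subr_ge0 xt lerBlDr (le_trans tT)// lerDl.
rewrite (le_trans (MP _ _ tx))// -!mulrA ler_wpM2l//.
rewrite (le_trans (F_lipschitz _ _ x0))// ler_wpM2l//.
by apply: uv; rewrite x0 (le_trans xt).
Qed.

Let picard (u : R -> X) (t : R) := S t u0 + convolution u t.
Let u_ n := iter n picard (fun t => S t u0).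

Lemma admissibleD (u v : R -> X) : admissible u -> admissible v -> admissible (fun t => u t + v t).
Proof.
move=> [uc ub] [vc vb]; split=> [t t0 e e0|T].
  have e2 : 0 < e / 2 by rewrite divr_gt0.
  have [d1 d10 d1P] := uc _ t0 _ e2; have [d2 d20 d2P] := vc _ t0 _ e2.
  exists (Num.min d1 d2) => [|y]; first by rewrite lt_min d10.
  rewrite -ltrBlDl lt_min => /and3P[ty y1 y2].
  rewrite opprD addrACA (le_lt_trans (ler_normD _ _))// [ltRHS]splitr ltrD//.
    by apply: d1P; rewrite ty -ltrBlDl.
  by apply: d2P; rewrite ty -ltrBlDl.
have [C CP] := ub T; have [D DP] := vb T.
exists (C + D) => t tT; rewrite (le_trans (ler_normD _ _))// lerD ?CP//.
exact: DP.
Qed.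

Let admissible_orbit : admissible (fun t => S t u0).
Proof.
split=> [t|T]; first exact: right_continuous_orbit.
have [M _ MP] := C0_semigroup_bound hS T.
by exists (M * `|u0|) => t; exact: MP.
Qed.

Let admissible_u n : admissible (u_ n).
Proof.
elim: n => [|n IH]; first exact: admissible_orbit.
by apply: admissibleD => //; exact: admissible_convolution.
Qed.

(** One application of [picard] multiplies the bound in the norm weighted by [expR (l * t)] by
    [M * K / l], which this [l] makes at most 1/2. *)
Let picard_step T M C l : 1 <= M -> (forall t z, 0 <= t <= T -> `|S t z| <= M * `|z|) ->
  l = 2 * M * K + 1 -> 0 <= C ->
  (forall t, 0 <= t <= T -> `|u_ 1%N t - u_ 0%N t| <= C) -> forall n t, 0 <= t <= T ->
  `|u_ n.+1 t - u_ n t| <= C * 2^-1 ^+ n * expR (l * t).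
Proof.
move=> M1 MP lE C0 C1.
have M0 : 0 <= M by exact: le_trans ler01 M1.
have l0 : 0 < l by rewrite lE ltr_wpDl// !mulr_ge0.
elim=> [|n IH] t tT.
  rewrite mulr1 (le_trans (C1 _ tT))// ler_peMr// -expR0 ler_expR.
  by rewrite mulr_ge0 ?(ltW l0)//; case/andP : tT.
rewrite /= /picard opprD addrACA subrr add0r.
apply: le_trans (convolution_lipschitz (admissible_u n.+1) (admissible_u n) M0 MP _ l0 IH tT) _.
  by rewrite mulr_ge0// exprn_ge0// invr_ge0.
rewrite exprS ler_pdivrMr//.
have h : 0 <= C * 2^-1 ^+ n * expR (l * t).
  by rewrite !mulr_ge0 ?expR_ge0// exprn_ge0// invr_ge0.
have -> : M * K * (C * 2^-1 ^+ n) * expR (l * t) = M * K * (C * 2^-1 ^+ n * expR (l * t)) by ring.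
have -> : C * (2^-1 * 2^-1 ^+ n) * expR (l * t) * l =
    (l / 2) * (C * 2^-1 ^+ n * expR (l * t)) by ring.
by rewrite ler_wpM2r// lE; lra.
Qed.

Let picard_cauchy T : exists2 C, 0 <= C & forall n t, 0 <= t <= T ->
  `|u_ n.+1 t - u_ n t| <= C * 2^-1 ^+ n.
Proof.
have [M M1 MP] := C0_semigroup_bound hS T.
have [C CP] := (admissible_convolution (admissible_u 0)).2 T.
have M0 : 0 <= M by exact: le_trans ler01 M1.
pose l := 2 * M * K + 1; have l0 : 0 <= l by rewrite addr_ge0// !mulr_ge0.
exists (`|C| * expR (l * T)); first by rewrite mulr_ge0 ?expR_ge0.
move=> n t tT; apply: le_trans (picard_step M1 MP (erefl l) (normr_ge0 C) _ n tT) _.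
  move=> s sT; rewrite /u_/= /picard addrAC subrr add0r (le_trans (CP _ sT))//.
  exact: ler_norm.
rewrite mulrAC ler_wpM2r ?exprn_ge0 ?invr_ge0// ler_wpM2l// ler_expR ler_wpM2l//.
by case/andP : tT.
Qed.

Lemma mild_solution_exists : exists u, global_mild_solution S F u0 u.
Proof.
(* The constant depends on the time horizon while [u] is chosen pointwise; asking for every valid
   [C] lets the estimate be used with the constant of any horizon. *)
have /choice[u uP] (t : R) : exists l, 0 <= t ->
    forall C, (forall n, `|u_ n.+1 t - u_ n t| <= C * 2^-1 ^+ n) ->
      forall n, `|l - u_ n t| <= 2 * C * 2^-1 ^+ n.
  have [t0|t0] := leP 0 t; last by exists 0.
  have [C C0 CP] := picard_cauchy t.
  have tt : 0 <= t <= t by rewrite t0 lexx.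
  have [l lP] := fast_cauchy_cvg (fun n => CP n t tt).
  exists l => _ D DP; have [l' l'P] := fast_cauchy_cvg DP.
  suff -> : l = l' by [].
  apply/eqP; rewrite -subr_eq0 -normr_le0.
  apply: (@le0_of_geometric _ _ (2 * C + 2 * D)) => n.
  rewrite -(subrKA (u_ n t)) (le_trans (ler_normD _ _))// mulrDl lerD ?lP//.
  by rewrite distrC.
have uC T : exists2 C, 0 <= C & forall n t, 0 <= t <= T -> `|u t - u_ n t| <= 2 * C * 2^-1 ^+ n.
  have [C C0 CP] := picard_cauchy T; exists C => // n t tT.
  by apply: uP => [|k]; [case/andP : tT|exact: CP].
have au : admissible u.
  split=> [t t0 e e0|T].
    have [C C0 CP] := uC (t + 1).
    have [N NP] : exists N, 2 * C * 2^-1 ^+ N < e / 3.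
      apply: contrapT => /forallNP H.
      have : e / 3 <= 0 by apply: (@le0_of_geometric _ _ (2 * C)) => n; rewrite leNgt; apply/negP/H.
      by rewrite leNgt divr_gt0.
    have e3 : 0 < e / 3 by rewrite divr_gt0.
    have [d d0 dP] := (admissible_u N).1 t t0 _ e3.
    exists (Num.min d 1) => [|y]; first by rewrite lt_min d0 ltr01.
    rewrite -ltrBlDl lt_min => /and3P[ty y1 y2].
    have h1 : `|u t - u_ N t| < e / 3 by apply: le_lt_trans NP; apply: CP; rewrite t0; lra.
    have h2 : `|u_ N t - u_ N y| < e / 3 by apply: dP; rewrite ty -ltrBlDl.
    have h3 : `|u y - u_ N y| < e / 3.
      by apply: le_lt_trans NP; apply: CP; apply/andP; split; lra.
    rewrite -(subrKA (u_ N y)) (le_lt_trans (ler_normD _ _))// [X in _ + X]distrC.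
    rewrite -(subrKA (u_ N t)).
    have := ler_normD (u t - u_ N t) (u_ N t - u_ N y).
    lra.
  have [C C0 CP] := uC T; have [D DP] := (admissible_u 0).2 T.
  exists (2 * C + D) => t tT.
  rewrite -[X in `|X|](subrK (u_ 0%N t)) (le_trans (ler_normD _ _))// lerD ?DP//.
  by have := CP 0%N t tT; rewrite expr0 mulr1.
exists u => t t0 _; exists (convolution u t); first exact: convolutionP.
have [C C0 CP] := uC t; have [M M1 MP] := C0_semigroup_bound hS t.
have M0 : 0 <= M by exact: le_trans ler01 M1.
have tt : 0 <= t <= t by rewrite t0 lexx.
apply/eqP; rewrite -subr_eq0 -normr_le0.
apply: (@le0_of_geometric _ _ (2 * C + M * K * (2 * C) * expR t)) => n.
have h0 : 0 <= 2^-1 ^+ n :> R by rewrite exprn_ge0// invr_ge0.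
have h1 := CP n.+1 t tt.
have h2 : `|convolution (u_ n) t - convolution u t| <= M * K * (2 * C * 2^-1 ^+ n) * expR t.
  have := @convolution_lipschitz (u_ n) u t M (2 * C * 2^-1 ^+ n) 1 t (admissible_u n) au M0 MP.
  rewrite divr1 mul1r; apply => //; first by rewrite !mulr_ge0.
  move=> s st; rewrite distrC mul1r (le_trans (CP _ _ st))// ler_peMr ?mulr_ge0//.
  by rewrite -expR0 ler_expR; case/andP : st.
have -> : u t - (S t u0 + convolution u t) =
    (u t - u_ n.+1 t) + (convolution (u_ n) t - convolution u t).
  exact: subrDB_add.
rewrite (le_trans (ler_normD _ _))// (le_trans (lerD h1 h2))//.
rewrite [leRHS]mulrDl; apply: lerD.
  by rewrite exprS ler_wpM2l ?mulr_ge0//; lra.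
by rewrite le_eqVlt; apply/orP; left; apply/eqP; ring.
Qed.

End existence.

(** * Uniqueness without local boundedness *)

Section uniqueness.
(** A Lipschitz estimate seen through [S s], the form in which the transported difference [y] can be
    estimated by itself. *)
Hypothesis F_dissipative : forall s t z z', 0 <= s -> 0 <= t ->
  `|S s (F t z - F t z')| <= K * `|S s (z - z')|.

Lemma mild_solution_unique u0 (u v : R -> X) : global_mild_solution S F u0 u ->
  global_mild_solution S F u0 v -> forall T, 0 <= T -> u T = v T.
Proof.
move=> hu hv T T0.
pose y t := S (T - t) (u t - v t).
pose f t := S (T - t) (F t (u t)) - S (T - t) (F t (v t)).
have fy t : 0 <= t <= T -> `|f t| <= K * `|y t|.
  by move=> /andP[t0 tT]; rewrite /f -linearB F_dissipative// subr_ge0.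
have bf t : 0 <= t <= T -> bochner_integral 0 t f (y t).
  move=> /andP[t0 tT]; have Tt : 0 <= T - t by rewrite subr_ge0.
  have [C C0 CP] := continuous_linear_bound (contS Tt).
  have [v1 v1P v1E] := hu t t0 (ltry _); have [v2 v2P v2E] := hv t t0 (ltry _).
  have -> : y t = S (T - t) (v1 - v2).
    by rewrite /y v1E v2E opprD addrACA subrr add0r.
  apply: bochner_eq (bochner_linear CP (bochnerB v1P v2P)) => s.
  rewrite in_itv/= => /andP[s0 st].
  by rewrite linearB -!SD ?subr_ge0// subrKA.
have TT : 0 <= T <= T by rewrite T0 lexx.
(* [f] does not depend on the upper limit [t], so the integral of its norm over [[0, T]], finite
   since [y T] is a Bochner integral, bounds every [y t]. *)
have [G G0 yG] : exists2 G, 0 <= G & forall t, 0 <= t <= T -> `|y t| <= G.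
  pose I := (\int[leb]_(x in (`[0%R, T] : set lebR)) `|f x|%:E)%E.
  have I0 : (0 <= I)%E by exact: integral_ge0.
  have Ifin : I \is a fin_num by rewrite ge0_fin_numE//; exact: bochner_fin (bf _ TT).
  exists (fine I); first by rewrite fine_ge0.
  move=> t tT; rewrite -lee_fin fineK//; apply: le_trans (bochner_norm_le (bf t tT)) _.
  apply: (@ge0_subset_integral _ _ _ leb _ _ (measurable_lebR_itv 0 t) (measurable_lebR_itv 0 T)).
  - exact: bochner_measurable (bf _ TT).
  - by move=> x _; rewrite lee_fin.
  - move=> x; rewrite /= !in_itv/= => /andP[-> xt]; apply: le_trans xt _.
    by case/andP : tT.
(* Gronwall by iteration: since [K / l <= 1 / 2], each use of the integral equation halves the
   weighted bound. *)
pose l := 2 * K + 1; have l0 : 0 < l by rewrite ltr_wpDl// mulr_ge0.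
have yn n t : 0 <= t <= T -> `|y t| <= G * 2^-1 ^+ n * expR (l * t).
  elim: n t => [|n IH] t tT; have /andP[t0 tT'] := tT.
    rewrite mulr1 (le_trans (yG _ tT))// ler_peMr// -expR0 ler_expR.
    by rewrite mulr_ge0// ltW.
  have h0 : 0 <= G * 2^-1 ^+ n by rewrite mulr_ge0// exprn_ge0// invr_ge0.
  have := bochner_le_scale_expR (mulr_ge0 K0 h0) l0 t0 (bf t tT).
  move=> /(_ _)/le_trans; apply.
    move=> x /andP[x0 xt]; have xT : 0 <= x <= T by rewrite x0 (le_trans xt).
    by rewrite (le_trans (fy _ xT))// -mulrA ler_wpM2l// IH.
  rewrite ler_pdivrMr// exprS.
  have h : 0 <= G * 2^-1 ^+ n * expR (l * t) by rewrite mulr_ge0 ?expR_ge0.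
  have -> : K * (G * 2^-1 ^+ n) * expR (l * t) = K * (G * 2^-1 ^+ n * expR (l * t)) by ring.
  have -> : G * (2^-1 * 2^-1 ^+ n) * expR (l * t) * l =
    (l / 2) * (G * 2^-1 ^+ n * expR (l * t)) by ring.
  by rewrite ler_wpM2r// /l; lra.
have : `|y T| <= 0.
  apply: (@le0_of_geometric _ _ (G * expR (l * T))) => n.
  by rewrite mulrAC; exact: yn.
by rewrite normr_le0 /y subrr S0 subr_eq0 => /eqP.
Qed.

End uniqueness.
End mild_solutions.

(** * Completeness of L2 *)

(** The ratio 1/4 leaves room in L2: squared differences weighted by 4^n still have integrals of
    order 4^-n, hence summable. *)
Definition fast_complete (R : realType) (V : normedModType R) :=
  forall (x : nat -> V) (C : R), (forall n, `|x n.+1 - x n| <= C * 4^-1 ^+ n) ->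
    exists l : V, x n @[n --> \oo] --> l.

Lemma cvg_geometric_bound (R : realType) (V : normedModType R) (x : nat -> V) l (C : R) :
  (forall n, `|l - x n| <= C * 2^-1 ^+ n) -> x n @[n --> \oo] --> l.
Proof.
move=> xl; apply/cvgrPdist_le => e e0.
have c0 : (C * 2^-1 ^+ n) @[n --> \oo] --> (0 : R).
  rewrite -(mulr0 C); apply: cvgMr; apply: cvg_expr; rewrite ger0_norm ?invr_ge0//.
  by rewrite invf_lt1 ?ltr1n.
move/cvgrPdist_le : c0 => /(_ e e0); apply: filterS => n.
by rewrite sub0r normrN => /(le_trans (ler_norm _)); exact: le_trans.
Qed.

Lemma limn_einf_le (R : realType) (u : nat -> \bar R) c :
  (forall n, u n <= c)%E -> (limn_einf u <= c)%E.
Proof.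
move=> uc; rewrite limn_einf_lim; apply: lime_le; first exact: is_cvg_einfs.
by apply: nearW => n; apply: le_trans (uc n); apply: ereal_inf_lbound; exists n => /=.
Qed.

Lemma limn_einf_ge0 (R : realType) (u : nat -> \bar R) :
  (forall n, 0 <= u n)%E -> (0 <= limn_einf u)%E.
Proof.
move=> u0; rewrite limn_einf_lim; apply: lime_ge; first exact: is_cvg_einfs.
by apply: nearW => n; apply: le_ereal_inf_tmp => _ [m _ <-].
Qed.

Section riesz_fischer.
Context d (T : measurableType d) (R : realType) (mu : {measure set T -> \bar R}).
Local Notation L := (LspaceType mu (lee1n 2)).

Lemma measurable_Lspace_fun (z : L) : measurable_fun setT (Lspace_fun z).
Proof. by have /andP[] := Lspace_funP z; rewrite inE. Qed.

Lemma integral_sqr_Lnorm (f : T -> R) :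
  (\int[mu]_x (f x ^+ 2)%:E = 'N[mu]_2%:E[EFin \o f] `^ 2)%E.
Proof.
rewrite powR_Lnorm//; apply: eq_integral => x _.
by rewrite /= powR_mulrn// real_normK ?num_real.
Qed.

Lemma integral_sqr_Lspace (z : L) :
  (\int[mu]_x (Lspace_fun z x ^+ 2)%:E = (`|z| ^+ 2)%:E)%E.
Proof.
rewrite integral_sqr_Lnorm.
have fin : ('N[mu]_2%:E[EFin \o Lspace_fun z])%E \is a fin_num.
  rewrite fin_numElt (lt_le_trans (ltNyr 0) (Lnorm_ge0 _ _ _))/=.
  by have /andP[_] := Lspace_funP z; rewrite inE.
have -> : `|z| = fine ('N[mu]_2%:E[EFin \o Lspace_fun z])%E by [].
rewrite -[in LHS](fineK fin) poweR_EFin powR_mulrn//.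
by rewrite fine_ge0// Lnorm_ge0.
Qed.

Lemma Lfun2P (f : T -> R) : measurable_fun setT f ->
  (\int[mu]_x (f x ^+ 2)%:E < +oo)%E -> f \in Lfun mu 2%:E.
Proof.
move=> mf fi; apply/andP; split; rewrite inE//=.
rewrite /finite_norm; apply: (@lty_poweRy _ _ 2) => //.
by rewrite -integral_sqr_Lnorm.
Qed.

Lemma Lspace_funB (y z : L) : Lspace_fun (y - z) = Lspace_fun y \- Lspace_fun z %[ae mu].
Proof.
move: (Lspace_funD y (- z)) (Lspace_oppE z).
apply: filterS2 => x /(_ I) + /(_ I) + _ => /= -> h.
by rewrite -[in RHS]h.
Qed.

Lemma integral_sqr_LspaceB (y z : L) :
  (\int[mu]_x ((Lspace_fun y x - Lspace_fun z x) ^+ 2)%:E = (`|y - z| ^+ 2)%:E)%E.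
Proof.
rewrite -integral_sqr_Lspace; have my := measurable_Lspace_fun y.
have mz := measurable_Lspace_fun z; have myz := measurable_Lspace_fun (y - z).
apply: ge0_ae_eq_integral => //.
- by apply/measurable_EFinP/measurable_funX; exact: measurable_funB.
- by apply/measurable_EFinP/measurable_funX.
- by move=> x _; rewrite lee_fin sqr_ge0.
- by move=> x _; rewrite lee_fin sqr_ge0.
- by apply: filterS (Lspace_funB y z) => x /(_ I) + _ => ->.
Qed.

(* With a_n the successive differences, sum_n 4^n a_n^2 is integrable, hence
   finite a.e., so a_n = O(2^-n) pointwise a.e.; Fatou's lemma bounds the distance
   to the pointwise limit. *)
Lemma Lspace_fast_complete : fast_complete L.
Proof.
move=> x C xC.
pose g n := Lspace_fun (x n).
have mg n : measurable_fun setT (g n) := measurable_Lspace_fun (x n).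
pose b n t := (4 ^+ n * (g n.+1 t - g n t) ^+ 2)%:E.
have mb n : measurable_fun setT (b n).
  apply/measurable_EFinP/measurable_funM => //.
  by apply: measurable_funX; exact: measurable_funB.
have b0 n t : (0 <= b n t)%E by rewrite lee_fin mulr_ge0 ?sqr_ge0// exprn_ge0.
have C0 : 0 <= C by have := le_trans (normr_ge0 _) (xC 0%N); rewrite expr0 mulr1.
have ib n : (\int[mu]_t b n t <= (C ^+ 2 * 4^-1 ^+ n)%:E)%E.
  rewrite /b; under eq_integral do rewrite EFinM.
  have h1 : measurable_fun setT (fun t => ((g n.+1 t - g n t) ^+ 2)%:E).
    by apply/measurable_EFinP/measurable_funX; exact: measurable_funB.
  have h2 t : setT t -> (0 <= ((g n.+1 t - g n t) ^+ 2)%:E)%E.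
    by rewrite lee_fin sqr_ge0.
  rewrite (@ge0_integralZl_EFin _ _ _ mu _ measurableT _ h2 h1 _ (exprn_ge0 _ (ler0n R 4))).
  rewrite integral_sqr_LspaceB -EFinM lee_fin.
  apply: (@le_trans _ _ (4 ^+ n * (C * 4^-1 ^+ n) ^+ 2)).
    by rewrite ler_wpM2l ?exprn_ge0// ler_pXn2r ?nnegrE ?mulr_ge0 ?exprn_ge0 ?invr_ge0.
  rewrite exprMn mulrCA ler_wpM2l ?sqr_ge0// expr2 mulrA -exprMn divff ?expr1n ?mul1r//.
have sumb : (\int[mu]_t (\sum_(n <oo) b n t) < +oo)%E.
  rewrite integral_nneseries//.
  apply: (@le_lt_trans _ _ (2 * C ^+ 2)%:E); last exact: ltry.
  apply: lime_le; first by apply: is_cvg_nneseries => n _ _; exact: integral_ge0.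
  apply: nearW => N; apply: (@le_trans _ _ (2 * C ^+ 2 * (1 - 4^-1 ^+ N))%:E); last first.
    by rewrite lee_fin ler_piMr ?mulr_ge0 ?sqr_ge0// gerBl exprn_ge0// invr_ge0.
  elim: N => [|N IH]; first by rewrite big_geq// expr0 subrr mulr0.
  rewrite big_nat_recr//=; apply: le_trans (leeD IH (ib N)) _.
  have h4 : 0 <= C ^+ 2 * 4^-1 ^+ N by rewrite mulr_ge0 ?sqr_ge0 ?exprn_ge0 ?invr_ge0.
  by rewrite -EFinD lee_fin [4^-1 ^+ N.+1]exprS; lra.
have aeb : {ae mu, forall t, (\sum_(n <oo) b n t)%E \is a fin_num}.
  have : mu.-integrable setT (fun t => \sum_(n <oo) b n t)%E.
    apply/integrableP; split.
      exact: ge0_emeasurable_sum.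
    under eq_integral => t _ do rewrite gee0_abs ?nneseries_ge0//.
    exact: sumb.
  move=> /(integrable_ae measurableT); apply: filterS => t; exact.
have gcvg : {ae mu, forall t, exists l : R, g n t @[n --> \oo] --> l}.
  apply: filterS aeb => t bt.
  pose B := fine (\sum_(n <oo) b n t)%E.
  have bB n : 4 ^+ n * (g n.+1 t - g n t) ^+ 2 <= B.
    rewrite -lee_fin fineK// -/(b n t).
    apply: le_trans (nneseries_lim_ge n.+1 _) => [|i _ _]; last exact: b0.
    by rewrite big_nat_recr//= leeDr// sume_ge0.
  have B0 : 0 <= B by rewrite (le_trans _ (bB 0%N))// mulr_ge0 ?sqr_ge0.
  have [|l lP] := @fast_cauchy_cvg R R (fun n => g n t) (Num.sqrt B).
    move=> n; rewrite -(@ler_pXn2r _ 2)// ?nnegrE ?mulr_ge0 ?sqrtr_ge0 ?exprn_ge0 ?invr_ge0//.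
    rewrite real_normK ?num_real// exprMn sqr_sqrtr// -exprM mulnC exprM.
    have -> : (2^-1 : R) ^+ 2 = 4^-1 by field.
    by rewrite exprVn ler_pdivlMr ?exprn_gt0// mulrC.
  by exists l; exact: cvg_geometric_bound lP.
(* The limsup is defined and measurable everywhere, and is the limit a.e. *)
pose gl t := fine (limn_esup (fun n => (g n t)%:E)).
have mgl : measurable_fun setT gl.
  apply: measurableT_comp; first exact: fine_measurable.
  by apply: measurable_fun_limn_esup => n; exact/measurable_EFinP.
have gglP : {ae mu, forall t, g n t @[n --> \oo] --> gl t}.
  apply: filterS gcvg => t [l gl_l].
  suff -> : gl t = l by [].
  have cl : (g n t)%:E @[n --> \oo] --> l%:E by apply: cvg_EFin => //; exact: nearW.
  by rewrite /gl (cvg_limn_einf_sup cl).2.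
(* Weakened to ratio 1/2 so that [fast_cauchy_dist] applies. *)
have xC2 n : `|x n.+1 - x n| <= C * 2^-1 ^+ n.
  rewrite (le_trans (xC n))// ler_wpM2l//; apply: lerXn2r; rewrite ?nnegrE ?invr_ge0//.
  by rewrite lef_pV2 ?posrE// ler_nat.
(* Fatou as [m] grows, applied to the squared distances from [x (n + m)] to [x n]. *)
have bound n : (\int[mu]_t ((gl t - g n t) ^+ 2)%:E <= ((2 * C * 2^-1 ^+ n) ^+ 2)%:E)%E.
  pose h m t := ((g (n + m)%N t - g n t) ^+ 2)%:E.
  have mh m : measurable_fun setT (h m).
    by apply/measurable_EFinP/measurable_funX; exact: measurable_funB.
  have h0 m t : (0 <= h m t)%E by rewrite lee_fin sqr_ge0.
  apply: (@le_trans _ _ (\int[mu]_t limn_einf (h ^~ t))%E).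
    apply: ae_ge0_le_integral => //.
    - by move=> t _; rewrite lee_fin sqr_ge0.
    - by apply/measurable_EFinP/measurable_funX; exact: measurable_funB.
    - by move=> t _; exact: limn_einf_ge0.
    - have mNh : measurable_fun setT (fun t => limn_esup ((fun m t => - h m t)%E ^~ t)).
        by apply: measurable_fun_limn_esup => m; exact: measurableT_comp.
      exact: (measurableT_comp (@oppe_measurable R setT) mNh).
    apply: filterS gglP => t gt _.
    have ht : h m t @[m --> \oo] --> ((gl t - g n t) ^+ 2)%:E.
      apply: cvg_EFin; first exact: nearW.
      have gt' : g (n + m)%N t @[m --> \oo] --> gl t.
        exact: (cvg_comp _ _ (cvg_addnl n) gt).
      by rewrite expr2; apply: cvgM; apply: cvgB => //; exact: cvg_cst.
    by rewrite (cvg_limn_einf_sup ht).1.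
  apply: le_trans (fatou _ measurableT mh (fun m t _ => h0 m t)) _.
  apply: limn_einf_le => m; rewrite /h integral_sqr_LspaceB lee_fin.
  rewrite ler_pXn2r ?nnegrE ?(fast_cauchy_dist xC2)//.
  by rewrite !mulr_ge0// exprn_ge0// invr_ge0.
(* [gl] is square integrable because [gl - g 0] and [g 0] are. *)
have glL : gl \in Lfun mu 2%:E.
  have h0 : (fun t => gl t - g 0%N t) \in Lfun mu 2%:E.
    apply: Lfun2P; first exact: measurable_funB.
    by apply: le_lt_trans (bound 0%N) _; rewrite ltry.
  rewrite (_ : gl = (fun t => gl t - g 0%N t) \+ g 0%N).
    by apply: (Lfun_addr_closed _ (lee1n 2)).2 => //; exact: Lspace_funP.
  by apply/funext => t /=; rewrite subrK.
exists (Lspace_mk mu (lee1n 2) gl : L); apply: (@cvg_geometric_bound _ _ _ _ (2 * C)) => n.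
rewrite -(@ler_pXn2r _ 2)// ?nnegrE ?mulr_ge0 ?exprn_ge0 ?invr_ge0//.
rewrite -lee_fin -integral_sqr_LspaceB; apply: le_trans (bound n).
have mlk := measurable_Lspace_fun (Lspace_mk mu (lee1n 2) gl).
apply: ae_ge0_le_integral => //.
- by move=> t _; rewrite lee_fin sqr_ge0.
- by apply/measurable_EFinP/measurable_funX; exact: (measurable_funB mlk (mg n)).
- by move=> t _; rewrite lee_fin sqr_ge0.
- by apply/measurable_EFinP/measurable_funX; exact: (measurable_funB mgl (mg n)).
- by apply: filterS (Lspace_mkE (lee1n 2) glL) => t /(_ I) + _ => ->.
Qed.


End riesz_fischer.

Section fast_completeness.
Context (R : realType).

(** Centres of balls of radius 4^-n belonging to the filter form a fast Cauchy sequence, since any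
    two sets of a proper filter meet; the filter converges to its limit. *)
Lemma fast_complete_cauchy (V : normedModType R) : fast_complete V ->
  forall F : set_system V, ProperFilter F -> cauchy F -> cvg F.
Proof.
move=> Vfast F FF /cauchyP F_cauchy.
pose e n : R := 4^-1 ^+ n; have e0 n : 0 < e n by rewrite exprn_gt0// invr_gt0.
have /choice[x xP] n : exists x : V, F (ball x (e n)) by exact: F_cauchy.
have e1 n : e n.+1 <= e n by rewrite /e exprS ger_pMl ?exprn_gt0 ?invr_gt0// invf_le1// ler1n.
have dist n p : `|x n - x p| <= e n + e p.
  have [z [nz pz]] := filter_ex (filterI (xP n) (xP p)).
  move: nz pz; rewrite -!ball_normE /= => nz pz.
  rewrite -(subrKA z) (le_trans (ler_normD _ _))// lerD// ltW//.
  by rewrite distrC.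
have [|l xl] := Vfast x 2.
  move=> n; rewrite (le_trans (dist _ _))//.
  by have := e1 n; rewrite /e; lra.
apply/cvg_ex; exists l; apply/cvgrPdist_lt => eps eps0.
have eps2 : 0 < eps / 2 by rewrite divr_gt0.
have c0 : e n @[n --> \oo] --> (0 : R).
  apply: cvg_expr; rewrite ger0_norm ?invr_ge0//.
  by rewrite invf_lt1 ?ltr1n.
have [n [ln en]] : exists n, `|l - x n| < eps / 2 /\ e n < eps / 2.
  apply: (@filter_ex _ \oo); apply: filterI.
    by move/cvgrPdist_lt : xl; exact.
  move/cvgrPdist_lt : c0 => /(_ _ eps2); apply: filterS => n.
  by rewrite sub0r normrN gtr0_norm.
apply: filterS (xP n) => y; rewrite -ball_normE /= => xy.
rewrite -(subrKA (x n)) (le_lt_trans (ler_normD _ _))// [ltRHS]splitr ltrD//.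
exact: lt_trans en.
Qed.

Lemma normr_component (V : normedModType R) s (z : l2_product V s) j : `|z j| <= `|z|.
Proof.
have -> : `|z| = Num.sqrt (\sum_j `|z j| ^+ 2) by [].
rewrite -[leLHS]ger0_norm// -sqrtr_sqr ler_wsqrtr// (bigD1 j)//= lerDl.
by apply: sumr_ge0 => i _; exact: sqr_ge0.
Qed.

Lemma normr_le_sum_component (V : normedModType R) s (z : l2_product V s) :
  `|z| <= \sum_j `|z j|.
Proof.
have -> : `|z| = Num.sqrt (\sum_j `|z j| ^+ 2) by [].
have S0 : 0 <= \sum_j `|z j| by exact: sumr_ge0.
rewrite -[leRHS]ger0_norm// -sqrtr_sqr ler_wsqrtr//.
rewrite [leRHS]expr2 mulr_suml; apply: ler_sum => j _.
rewrite expr2 ler_wpM2l// (bigD1 j)//= lerDl.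
exact: sumr_ge0.
Qed.

Lemma l2_product_fast_complete (V : normedModType R) s : fast_complete V ->
  fast_complete (l2_product V s).
Proof.
move=> Vfast x C xC.
have /choice[l lP] (j : 'I_s) : exists l : V, x n j @[n --> \oo] --> l.
  apply: (Vfast _ C) => n; apply: le_trans (xC n).
  by apply: le_trans (normr_component _ j); rewrite !ffunE.
exists ([ffun j => l j] : l2_product V s).
apply/cvgrPdist_le => e e0.
have s1 : 0 < s%:R + 1 :> R by rewrite ltr_wpDl.
have es : 0 < e / (s%:R + 1) by rewrite divr_gt0.
have : \forall n \near \oo, forall j, `|l j - x n j| <= e / (s%:R + 1).
  by apply: filter_forall => j; move/cvgrPdist_le : (lP j); exact.
apply: filterS => n nP; apply: le_trans (normr_le_sum_component _) _.
apply: (@le_trans _ _ (\sum_(j < s) (e / (s%:R + 1)))).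
  by apply: ler_sum => j _; rewrite !ffunE.
rewrite sumr_const card_ord -[leLHS]mulr_natr mulrAC ler_pdivrMr// ler_wpM2l ?(ltW e0)//.
by rewrite lerDl.
Qed.

End fast_completeness.

(** * The reaction term *)

Lemma generatorZ (R : realType) (X : completeNormedModType R) (A : X -> X -> Prop)
    (S : R -> {linear X -> X}) (a : R) z w : generates A S ->
  A z w -> A (a *: z) (a *: w).
Proof.
move=> hA /(generatorP hA) Azw; apply/(generatorP hA) => e e0.
have a1 : 0 < `|a| + 1 by rewrite ltr_wpDl.
have [d d0 dP] := Azw _ (divr_gt0 e0 a1); exists d => // t td.
have -> : S t (a *: z) - a *: z - t *: (a *: w) = a *: (S t z - z - t *: w).
  by rewrite (linearZ_LR (S t)) !scalerBr !scalerA mulrC.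
have /andP[t0 _] := td.
rewrite normrZ (le_trans (ler_wpM2l (normr_ge0 a) (dP _ td)))//.
rewrite mulrA ler_wpM2r// mulrA ler_pdivrMr// mulrC ler_wpM2l ?(ltW e0)//; lra.
Qed.

Lemma right_continuous_within (R : realType) (h : R -> R) (t : R) : 0 <= t ->
  h x @[x --> within [set y | 0 <= y] (nbhs t)] --> h t -> right_continuous_at h t.
Proof.
move=> t0 ht; apply/cvg_at_right_epsP; apply: cvg_trans ht; apply: cvg_app.
move=> P; rewrite /at_right !withinE => -[B Bt PB]; exists B => //.
apply/seteqP; split=> y [Py ty]; split => //.
- have : (P `&` [set y | 0 <= y]) y by split => //=; rewrite (le_trans t0)// ltW.
  by rewrite PB => -[].
- have : (B `&` [set y | 0 <= y]) y by split => //=; rewrite (le_trans t0)// ltW.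
  by rewrite -PB => -[].
Qed.

(** * Affine reactions whose linear parts preserve the generator *)

Section affine_reaction.
Context (R : realType) (X : completeNormedModType R).
Variables (A : X -> X -> Prop) (S : R -> {linear X -> X}) (hA : generates A S).
Variables (r : nat) (D : 'I_r -> {linear X -> X}) (c : 'I_r -> X).
Hypothesis D_continuous : forall q, continuous (D q).
Hypothesis D_generator : forall q z w, A z w -> A (D q z) (D q w).
Variables (h : 'I_r -> R -> R) (d : 'I_r -> R).
Hypothesis h_continuous : forall q, ae_continuous_ge0 (h q).
Hypothesis h_bound : forall q t, 0 <= t -> 0 <= h q t <= d q.
Variable F : R -> X -> X.
Hypothesis FE : forall t z, F t z = \sum_q h q t *: (D q z + c q).

Let FB t z z' : F t z - F t z' = \sum_q h q t *: D q (z - z').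
Proof.
rewrite !FE -sumrB; apply: eq_bigr => q _.
by rewrite -scalerBr opprD addrACA subrr addr0 [D q (z - z')]linearB.
Qed.

Lemma mild_solution_affine u0 : exists u, global_mild_solution S F u0 u /\
  forall v, global_mild_solution S F u0 v -> forall t, 0 <= t -> v t = u t.
Proof.
have hS : C0_semigroup S by case: hA.
have /choice[C CP] q : exists C, 0 <= C /\ forall z, `|D q z| <= C * `|z|.
  by have [C C0 CP] := continuous_linear_bound (@D_continuous q); exists C.
pose K := \sum_q d q * C q; pose K' := \sum_q d q * `|c q|.
have d0 q : 0 <= d q by have /andP[] := h_bound q (lexx 0); exact: le_trans.
have K0 : 0 <= K by apply: sumr_ge0 => q _; rewrite mulr_ge0//; case: (CP q).
have normF t (w : X) : 0 <= t -> `|\sum_q h q t *: D q w| <= K * `|w|.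
  move=> t0; rewrite (le_trans (ler_norm_sum _ _ _))// mulr_suml; apply: ler_sum => q _.
  have /andP[h0 hd] := h_bound q t0.
  by rewrite normrZ ger0_norm// -mulrA ler_pM//; case: (CP q).
have F1 t z z' : 0 <= t -> `|F t z - F t z'| <= K * `|z - z'|.
  by move=> t0; rewrite FB; exact: normF.
have F2 t : 0 <= t -> `|F t 0| <= K'.
  move=> t0; rewrite FE (le_trans (ler_norm_sum _ _ _))//; apply: ler_sum => q _.
  have /andP[h0 hd] := h_bound q t0.
  by rewrite linear0 add0r normrZ ger0_norm// ler_wpM2r.
have F3 : {ae @completed_lebesgue_measure R, forall t : lebR R, 0 <= (t : R) ->
    forall z, right_continuous_at (F ^~ z) t}.
  have := @filter_forall _ _ _ _ (@ae_leb_filter R) h_continuous.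
  apply: filterS => t ht t0 z.
  apply/cvg_at_right_epsP; rewrite FE.
  rewrite (_ : F ^~ z = fun y => \sum_q h q y *: (D q z + c q)); last first.
    by apply/funext => y; rewrite FE.
  apply: cvg_big => [|q _]; first exact: add_continuous.
  apply: cvgZr_tmp; apply/cvg_at_right_epsP.
  by apply: right_continuous_within => //; exact: ht.
have [u uP] := mild_solution_exists hS K0 F1 F2 F3 u0.
exists u; split => // v vP t t0.
apply: (mild_solution_unique hS K0 _ vP uP t0) => s t' z z' s0 t'0.
(* Once [S s] is moved inside each [D q], the Lipschitz estimate of [F] applies to the vector
   [S s (z - z')]. *)
rewrite FB (_ : S s _ = \sum_q h q t' *: D q (S s (z - z'))); first exact: normF.
rewrite linear_sum; apply: eq_bigr => q _.
rewrite (linearZ_LR (S s)); congr (_ *: _).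
by apply: (semigroup_commute hA) => //; exact: D_generator.
Qed.

End affine_reaction.

(** * The concrete reaction term in affine form *)

Section reaction_affine.
Context (R : realType) (m : nat) (Omega : set 'rV[R]_m) (oOmega : open Omega).
Local Notation mu := (domain_measure oOmega).

Lemma state_complete s (F : set_system (state oOmega s)) :
  ProperFilter F -> cauchy F -> cvg F.
Proof.
apply: fast_complete_cauchy; apply: l2_product_fast_complete.
exact: Lspace_fast_complete.
Qed.

HB.instance Definition _ s := Uniform_isComplete.Build (state oOmega s) (@state_complete s).

Lemma Lspace_fun_sum (J : Type) (e : seq J) (a : J -> R) (y : J -> L2 oOmega) :
  Lspace_fun (\sum_(i <- e) a i *: y i) =
  (fun x => \sum_(i <- e) a i * Lspace_fun (y i) x) %[ae mu].
Proof.
elim: e => [|i e IH].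
  rewrite big_nil; under [X in _ = X %[ae mu]]eq_fun do rewrite big_nil.
  exact: Lspace_zeroE.
rewrite big_cons; under [X in _ = X %[ae mu]]eq_fun do rewrite big_cons.
move: IH (Lspace_funD (a i *: y i) (\sum_(k <- e) a k *: y k)) (Lspace_funZ (a i) (y i)).
apply: filterS3 => x /(_ I) + /(_ I) + /(_ I) + _ => /= + -> => -> ->.
by [].
Qed.

Section component_map.
Variables (s : nat) (b : 'I_s -> R) (j0 : 'I_s).
Local Notation X := (state oOmega s).

(** The action of a matrix whose only nonzero column is [b], in position [j0]: the linear part of a
    monomial z_j0 with stoichiometric coefficients [b]. *)
Definition component_map (z : X) : X := [ffun j => b j *: z j0].

Lemma component_map_is_linear : linear component_map.
Proof.
move=> a y z; apply/ffunP => j; rewrite !ffunE.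
by rewrite scalerDr !scalerA mulrC.
Qed.

HB.instance Definition _ := GRing.isLinear.Build R X X _ component_map component_map_is_linear.

Lemma component_map_continuous : continuous component_map.
Proof.
apply: bounded_linear_continuous; apply/linear_boundedP.
exists (\sum_j `|b j|); split; first exact: num_real.
move=> a ba z; apply: le_trans (normr_le_sum_component _) _.
apply: (@le_trans _ _ (\sum_j (`|b j| * `|z|))).
  apply: ler_sum => j _; rewrite ffunE normrZ ler_wpM2l//.
  exact: normr_component.
by rewrite -mulr_suml ler_wpM2r// ltW.
Qed.

(* [adv_diff_sys] is componentwise, so with z also the constant family
   (z_j0, ..., z_j0) lies in the domain; its multiples by the b_j do too, as the
   graph of a generator is linear, and they supply the components of the image. *)
Lemma component_map_generator (k vel : 'I_m -> R) (S : R -> {linear X -> X}) z w :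
  generates (@adv_diff_sys R m Omega oOmega s k vel) S ->
  adv_diff_sys k vel z w -> adv_diff_sys k vel (component_map z) (component_map w).
Proof.
move=> hA Azw j.
have Ac : adv_diff_sys k vel ([ffun=> z j0] : X) [ffun=> w j0].
  by move=> i; rewrite !ffunE; exact: Azw.
have := generatorZ (b j) hA Ac j.
by rewrite !ffunE.
Qed.

End component_map.

Section reaction_decomposition.
Hypothesis bOmega : bounded_set Omega.
Variables (s r : nat) (lc rc : 'I_s -> 'I_r -> nat) (hH : conditionH lc).
Variables (k vel : 'I_m -> R).
Local Notation X := (state oOmega s).
Variables (S : R -> {linear X -> X})
  (hS : generates (@adv_diff_sys R m Omega oOmega s k vel) S).

Let coef j q : R := (rc j q)%:R - (lc j q)%:R.

Lemma cst1_Lfun : cst 1 \in Lfun mu 2%:E.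
Proof.
apply/andP; split; rewrite inE //=.
rewrite /finite_norm Lnorm_cst1 poweR_lty//.
exact: domain_measure_fin.
Qed.

(** Condition (H) leaves two cases: the monomial is 1, which gives a constant state in L2 because
    the domain has finite measure, or it is one component z_j0, which gives a [component_map]. *)
Lemma monomial_affine q : exists Dc : {linear X -> X} * X,
  [/\ continuous Dc.1,
      forall z w, adv_diff_sys k vel z w -> adv_diff_sys k vel (Dc.1 z) (Dc.1 w) &
      forall z j, Lspace_fun ((Dc.1 z + Dc.2) j) =
        (fun x => coef j q * \prod_(v < s) Lspace_fun (z v) x ^+ lc v q) %[ae mu]].
Proof.
have [l0|[j0 [[l1 l0] _]]] := hH q.
  pose c : X := [ffun j => coef j q *: Lspace_mk mu (lee1n 2) (cst 1)].
  exists (\0 : {linear X -> X}, c); split => /=.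
  - by move=> z; exact: cst_continuous.
  (* The pair (0, 0) is in the graph of any generator, which spares exhibiting weak derivatives of
     0; the radius 1 is arbitrary. *)
  - move=> z w _; apply/(generatorP hS) => e e0; exists 1 => // t /andP[t0 _].
    by rewrite /GRing.null_fun linear0 scaler0 !subrr normr0 mulr_ge0 ?(ltW e0).
  - move=> z j; rewrite add0r ffunE.
    move: (Lspace_funZ (coef j q) (Lspace_mk mu (lee1n 2) (cst 1)))
      (Lspace_mkE (lee1n 2) cst1_Lfun).
    apply: filterS2 => x /(_ I) + /(_ I) + _ => /= -> ->.
    by rewrite big1// => v _; rewrite l0 expr0.
exists (component_map (coef ^~ q) j0 : {linear X -> X}, 0); split => /=.
- exact: component_map_continuous.
- by move=> z w Azw; exact: (component_map_generator (coef ^~ q) j0 hS Azw).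
- move=> z j; rewrite addr0 ffunE.
  apply: filterS (Lspace_funZ (coef j q) (z j0)) => x /(_ I) + _ => /= ->.
  rewrite (bigD1 j0)//= l1 expr1 big1 ?mulr1// => v /eqP vj.
  by rewrite l0// expr0.
Qed.

Lemma state_component_sum (J : Type) (e : seq J) (f : J -> X) j :
  (\sum_(i <- e) f i) j = \sum_(i <- e) f i j.
Proof.
by apply: (big_morph (fun z : X => z j)) => [y z|]; rewrite ffunE.
Qed.

Lemma reaction_affine (h : 'I_r -> R -> R) (Dc : 'I_r -> {linear X -> X} * X) :
  (forall q z j, Lspace_fun (((Dc q).1 z + (Dc q).2) j) =
     (fun x => coef j q * \prod_(v < s) Lspace_fun (z v) x ^+ lc v q) %[ae mu]) ->
  forall t z, reaction lc rc h t z = \sum_q h q t *: ((Dc q).1 z + (Dc q).2).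
Proof.
move=> DcE t z; apply/ffunP => j; rewrite ffunE state_component_sum.
under [RHS]eq_bigr do rewrite ffunE.
apply: Lspace_eqP.
have := @filter_forall _ _ _ _ (ae_filter_ringOfSetsType mu) (fun q => DcE q z j).
move: (Lspace_mkE (lee1n 2) (reaction_fun_Lfun bOmega rc h j t z hH)).
move: (Lspace_fun_sum (index_enum 'I_r) (fun q => h q t) (fun q => ((Dc q).1 z + (Dc q).2) j)).
apply: filterS3 => x /(_ I) + /(_ I) + h3 _ => -> ->.
rewrite /reaction_fun; apply: eq_bigr => q _; rewrite (h3 q I).
by rewrite mulrA [h q t * _]mulrC.
Qed.

End reaction_decomposition.
End reaction_affine.

Theorem theorem4p2 (R : realType) (m : nat) (hm : (1 <= m <= 3)%N)
    (Omega : set 'rV[R]_m) (oOmega : open Omega) (bOmega : bounded_set Omega)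
    (s r : nat) (hs : (0 < s)%N) (hr : (0 < r)%N)
    (k vel : 'I_m -> R) (hk : forall i, 0 < k i) (hvel : forall i, 0 < vel i)
    (S : R -> {linear state oOmega s -> state oOmega s})
    (hS : generates (@adv_diff_sys R m Omega oOmega s k vel) S)
    (lc rc : 'I_s -> 'I_r -> nat)
    (h : 'I_r -> R -> R) (hcont : forall q, ae_continuous_ge0 (h q))
    (d : 'I_r -> R) (hd : forall q, 0 < d q)
    (hbound : forall q t, 0 <= t -> 0 <= h q t <= d q)
    (hH : conditionH lc) (u0 : state oOmega s) :
  exists u : R -> state oOmega s,
    global_mild_solution S (reaction lc rc h) u0 u /\
    forall v : R -> state oOmega s,
      global_mild_solution S (reaction lc rc h) u0 v ->
      forall t, 0 <= t -> v t = u t.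
Proof.
have /choice[Dc DcP] := monomial_affine bOmega rc hH hS.
apply: (mild_solution_affine hS (D := fun q => (Dc q).1) (c := fun q => (Dc q).2) _ _ hcont hbound).
- by move=> q; case: (DcP q).
- by move=> q z w; case: (DcP q) => _ + _; exact.
- by apply: (reaction_affine bOmega hH) => q z j; case: (DcP q).
Qed.
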